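(* Let $k$ be a field of characteristic zero, $A_2=k[[X_1,\ldots,X_n]]$, and let $f_1,\ldots,f_n\in A_2$ be a regular sequence in the maximal ideal of $A_2$, generating the (primary to the maximal ideal) ideal $I=(f_1,\ldots,f_n)$. Let $A_1=k[[U_1,\ldots,U_n]]$ and regard $A_2$ as an $A_1$-module via the $k$-algebra morphism $F^*:A_1\to A_2$, $U_i\mapsto f_i$; this module is free of finite rank $e(I)$. Let $g\in A_2$ and let $$P_g(Y,U)=Y^{e(I)}+\sum_{i=1}^{e(I)}a_i(U_1,\ldots,U_n)\,Y^{e(I)-i}\in A_1[Y]$$ be the characteristic polynomial of the $A_1$-linear endomorphism $m_g:A_2\to A_2$ of multiplication by $g$. Put $$\alpha=\min_{1\le i\le e(I)}\frac{\mathrm{ord}_U\,a_i(U)}{i},\qquad \text{where } \mathrm{ord}_U\,a=\max\{m\in\mathbb{N} : a\in (U)^m\},\ (U)=(U_1,\ldots,U_n).$$ Then $\overline{v_I}(g)=\alpha$.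
   Context: $e(I)$ denotes the Samuel multiplicity of $I$ (here equal to $\dim_k A_2/I$). Convention: $\mathrm{ord}_U\,0=+\infty$. Asymptotic Samuel function: set $\mathrm{ord}_I(x)=\max\{m\in\mathbb{N} : x\in I^m\}$ for $x\ne 0$ and $\mathrm{ord}_I(0)=+\infty$; then $\overline{v_I}(x)=\lim_{m\to+\infty}\mathrm{ord}_I(x^m)/m$ for $x\in A_2$. *)

(* Defs.v *)
From HB Require Import structures.
From mathcomp Require Import all_boot all_order all_algebra.
From mathcomp Require mpoly.
(* Only the structure instances of mpoly are imported: its notations clash with
   those of mathcomp-analysis. *)
Import (canonicals, coercions) mpoly.
From mathcomp Require Import boolp classical_sets functions reals ereal.
From mathcomp Require Import topology normedtype sequences.

Set Implicit Arguments.
Unset Strict Implicit.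
Unset Printing Implicit Defensive.

Import Order.TTheory GRing.Theory Num.Theory.
Import numFieldNormedType.Exports.

Local Open Scope classical_set_scope.
Local Open Scope ring_scope.

(* k[[X_1,...,X_n]]: a series is the family of its coefficients, indexed by the
   monomials of the multinomials library. *)
Definition fps (k : fieldType) (n : nat) : Type := mpoly.multinom n -> k.

Section FormalPowerSeries.
Variables (k : fieldType) (n : nat).
Implicit Types (a b c : fps k n) (m : mpoly.multinom n).

HB.instance Definition _ :=
  GRing.Zmodule.copy (fps k n) (mpoly.multinom n -> k).

Lemma fpsDE a b m : (a + b) m = a m + b m. Proof. by []. Qed.

Definition fpsC (x : k) : fps k n :=
  fun m => if m == mpoly.mnm0 then x else 0.

Definition fpsX (i : 'I_n) : fps k n := fun m => (m == mpoly.mnm1 i)%:R.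

(* The degree bounds only serve to make the index type finite: they hold for
   every pair of monomials with product m. *)
Definition fps_mul a b : fps k n := fun m =>
  \sum_(p : mpoly.bmultinom n (mpoly.mdeg m).+1
          * mpoly.bmultinom n (mpoly.mdeg m).+1 | m == mpoly.mnm_add p.1 p.2)
     a p.1 * b p.2.

Definition fps_scale (x : k) a : fps k n := fun m => x * a m.

(* The ring axioms are transferred from polynomials by truncation. *)
Definition fps_trunc (d : nat) a : mpoly.mpoly n k :=
  \sum_(m : mpoly.bmultinom n d) a m *: mpoly.mpolyX k m.

Lemma fps_truncE d a m : (mpoly.mdeg m < d)%N ->
  a m = mpoly.mcoeff m (fps_trunc d a).
Proof.
move=> md; rewrite /fps_trunc raddf_sum (bigD1 (mpoly.BMultinom md)) //=.
rewrite mpoly.mcoeffZ mpoly.mcoeffX eqxx mulr1 big1 ?addr0// => i ne.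
rewrite mpoly.mcoeffZ mpoly.mcoeffX; case: eqP => [E|_]; last by rewrite mulr0.
by case/eqP: ne; apply: val_inj.
Qed.

Lemma fps_mulE a b (p q : mpoly.mpoly n k) m :
  (forall m', (mpoly.mdeg m' <= mpoly.mdeg m)%N -> a m' = mpoly.mcoeff m' p) ->
  (forall m', (mpoly.mdeg m' <= mpoly.mdeg m)%N -> b m' = mpoly.mcoeff m' q) ->
  fps_mul a b m = mpoly.mcoeff m (p * q).
Proof.
move=> ap bq; rewrite mpoly.mcoeffM; apply: eq_bigr => -[i j] /= _.
by rewrite ap ?bq// -ltnS mpoly.bmdeg.
Qed.

Let truncP a m m' : (mpoly.mdeg m' <= mpoly.mdeg m)%N ->
  a m' = mpoly.mcoeff m' (fps_trunc (mpoly.mdeg m).+1 a).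
Proof. by move=> le; apply: fps_truncE; rewrite ltnS. Qed.

Let mul_truncP a b m m' : (mpoly.mdeg m' <= mpoly.mdeg m)%N ->
  fps_mul a b m' = mpoly.mcoeff m'
    (fps_trunc (mpoly.mdeg m).+1 a * fps_trunc (mpoly.mdeg m).+1 b).
Proof.
by move=> le; apply: fps_mulE => m'' le'; apply: truncP; apply: leq_trans le.
Qed.

Fact fps_mulC : commutative fps_mul.
Proof.
move=> a b; apply/funext => m.
rewrite (fps_mulE (truncP a (m:=m)) (truncP b (m:=m))) mulrC.
by rewrite -(fps_mulE (truncP b (m:=m)) (truncP a (m:=m))).
Qed.

Fact fps_mulA : associative fps_mul.
Proof.
move=> a b c; apply/funext => m.
rewrite (fps_mulE (truncP a (m:=m)) (mul_truncP b c (m:=m))) mulrA.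
by rewrite -(fps_mulE (mul_truncP a b (m:=m)) (truncP c (m:=m))).
Qed.

Fact fps_mul1 : left_id (fpsC 1) fps_mul.
Proof.
move=> a; apply/funext => m.
rewrite (@fps_mulE _ _ 1 _ _ _ (truncP a (m:=m))); last first.
  by move=> m' _; rewrite mpoly.mcoeff1 /fpsC; case: eqP.
by rewrite mul1r -fps_truncE.
Qed.

Fact fps_mulDl : left_distributive fps_mul +%R.
Proof.
move=> a b c; apply/funext => m; rewrite [RHS]fpsDE /fps_mul -big_split /=.
by apply: eq_bigr => p _; rewrite mulrDl.
Qed.

Fact fps_1_neq0 : fpsC 1 != 0 :> fps k n.
Proof.
apply/eqP => /(congr1 (fun a : fps k n => a mpoly.mnm0)).
by rewrite /fpsC eqxx => /eqP; rewrite oner_eq0.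
Qed.

HB.instance Definition _ := GRing.Zmodule_isComNzRing.Build (fps k n)
  fps_mulA fps_mulC fps_mul1 fps_mulDl fps_1_neq0.

Fact fps_scaleA x y a : fps_scale x (fps_scale y a) = fps_scale (x * y) a.
Proof. by apply/funext => m; rewrite /fps_scale mulrA. Qed.

Fact fps_scale1 : left_id 1 fps_scale.
Proof. by move=> a; apply/funext => m; rewrite /fps_scale mul1r. Qed.

Fact fps_scaleDr : right_distributive fps_scale +%R.
Proof. by move=> x a b; apply/funext => m; rewrite [RHS]fpsDE /fps_scale mulrDr. Qed.

Fact fps_scaleDl a : {morph fps_scale^~ a : x y / x + y}.
Proof. by move=> x y; apply/funext => m; rewrite [RHS]fpsDE /fps_scale mulrDl. Qed.

HB.instance Definition _ := GRing.Zmodule_isLmodule.Build k (fps k n)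
  fps_scaleA fps_scale1 fps_scaleDr fps_scaleDl.

End FormalPowerSeries.

(* The k-algebra morphism k[[U_1,...,U_p]] -> k[[X_1,...,X_n]], U_i |-> f_i, for
   f_i without constant term: then f^m has order at least |m|, so that only the
   monomials U^m with |m| <= |mu| contribute to the coefficient of X^mu. *)
Definition fps_subst (k : fieldType) (p n : nat) (f : 'I_p -> fps k n)
    (a : fps k p) : fps k n := fun mu =>
  \sum_(m : mpoly.bmultinom p (mpoly.mdeg mu).+1)
     a m * (\prod_(i < p) f i ^+ mpoly.fun_of_multinom m i) mu.

Section Ideals.
Variable A : comNzRingType.
Implicit Types (S I J : set A) (x : A).

Definition ideal_gen S : set A := [set x | exists s : seq (A * A),
  (forall p, p \in s -> S p.2) /\ x = \sum_(p <- s) p.1 * p.2].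

Definition ideal_mul I J : set A := ideal_gen [set x * y | x in I & y in J].

Definition ideal_exp I (m : nat) : set A := iter m (ideal_mul I) setT.

Definition regular_sequence (n : nat) (f : 'I_n -> A) : Prop :=
  (forall (i : 'I_n) x,
     ideal_gen [set f j | j in [set j : 'I_n | (j < i)%N]] (f i * x) ->
     ideal_gen [set f j | j in [set j : 'I_n | (j < i)%N]] x)
  /\ ~ ideal_gen (range f) 1.

(* Max of {m | x \in I^m}, and +oo when this set is unbounded; in particular
   the value at 0 is +oo. *)
Definition ideal_ord (R : realType) I x : \bar R :=
  ereal_sup [set m%:R%:E | m in [set m | ideal_exp I m x]].

Definition samuel_seq (R : realType) I x : nat -> \bar R :=
  fun m => (ideal_ord R I (x ^+ m) / m%:R%:E)%E.

Definition asymptotic_samuel (R : realType) I x : \bar R :=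
  limn (samuel_seq R I x).

End Ideals.

Definition max_ideal (k : fieldType) (n : nat) : set (fps k n) :=
  ideal_gen (range (@fpsX k n)).
Arguments max_ideal k n : clear implicits.

Definition dim_quotient (k : fieldType) (n : nat) (J : set (fps k n))
    (d : nat) : Prop :=
  exists b : 'I_d -> fps k n, forall x : fps k n,
    exists! c : {ffun 'I_d -> k}, J (x - \sum_(i < d) c i *: b i).

(* e = lim n! * length(A/I^m) / m^n; lengths are dimensions over k because k is
   the residue field. *)
Definition samuel_multiplicity (R : realType) (k : fieldType) (n : nat)
    (I : set (fps k n)) (e : nat) : Prop :=
  exists2 len : nat -> nat,
    forall m, dim_quotient (ideal_exp I m) (len m) &
    ((n`! * len m)%N%:R / m%:R ^+ n : R) @[m --> \oo] --> (e%:R : R).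

(* B is seen as an A-module through phi : A -> B. *)
Section ModuleVia.
Variables (A B : comNzRingType) (phi : A -> B).

Definition basis_via (e : nat) (b : 'I_e -> B) : Prop :=
  forall x : B, exists! c : {ffun 'I_e -> A}, x = \sum_(i < e) phi (c i) * b i.

Definition free_via (e : nat) : Prop := exists b : 'I_e -> B, basis_via b.

Definition char_poly_via (e : nat) (u : B -> B) (P : {poly A}) : Prop :=
  exists (b : 'I_e -> B) (M : 'M[A]_e),
    [/\ basis_via b,
        forall j, u (b j) = \sum_(i < e) phi (M i j) * b i &
        P = char_poly M].

End ModuleVia.

(* Main.v *)
Require Import Defs.
From HB Require Import structures.
From mathcomp Require Import all_boot all_order all_algebra.
From mathcomp Require Import boolp classical_sets functions reals ereal.
From mathcomp Require Import topology normedtype sequences.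
From mathcomp Require mpoly.
Import -(notations) mpoly.

Set Implicit Arguments.
Unset Strict Implicit.
Unset Printing Implicit Defensive.

Import Order.TTheory GRing.Theory Num.Theory.
Import numFieldNormedType.Exports.

Local Open Scope classical_set_scope.
Local Open Scope ring_scope.

(** Let A be the power series ring, e the dimension of A/I, and M the matrix of
    multiplication by g in a basis of A over the base ring A_1 of power series
    in f. The powers of I are read on coordinates: an element lies in I^m if
    and only if its coordinates have order at least m (ideal_exp_coords). The
    theorem compares the orders of the matrices M^N with those of the
    coefficients a_i of the characteristic polynomial P of M, in two
    inequalities that hold for each N > 0. Let alpha be the minimum of the
    quotients of the order of a_i by i.

    Lower bound (mul_exp_lower). For N >= e, by the Cayley-Hamilton relation,
    g^N is the sum of the - a_i g^(N-i), and induction on N shows that the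
    order of g^N is at least r (N - e) for each real r with 0 <= r <= alpha.

    Upper bound (mul_exp_weight). Suppose that g^N lies in I^m, so that the
    entries of M^N have order at least m. The determinant of Y^N - M^N is the
    product of P and of a monic cofactor. Give the variables of the base weight
    N and Y weight m: the least weight of a term is a valuation on A_1[Y]
    (has_weightM). The determinant has weight at least e N m, and the cofactor,
    which is monic of degree e (N - 1), has weight at most m e (N - 1). Hence P
    has weight at least m e, which says that the order of a_i is at least i m /
    N (char_poly_weight). So the order of g^N divided by N is at most alpha,
    and the limit follows by squeezing (cvg_linear_lower).

    It remains to see that A is free of rank e over A_1. The quotient A/I is
    finite dimensional (finite_quotient): if A is finite over d parameters
    modulo the first i terms of the sequence, then the determinant trick
    applied to the next term gives a nonzero power series in the parameters
    that vanishes modulo the first i + 1 terms (constant_term_relation); after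
    a generic linear change of the parameters it bounds a power of one of them,
    which can be dropped (parameter_step). A basis of A/I generates A over A_1
    by completeness (complete_nakayama), and it is free because the terms of
    the sequence can be divided out one at a time (subst_free_firsts). Finally
    the products of monomials in f of degree less than m and basis elements
    form a basis of A/I^m, so that the Samuel multiplicity is also e
    (dim_quotient_exp, cvg_card_bmultinom). *)

(** * Formal power series: order, convergence, division by the variables *)

Section Coefficients.
Variables (k : fieldType) (n : nat).
Implicit Types (a b c : fps k n) (m : multinom n).

Lemma fpsNE a m : (- a) m = - a m. Proof. by []. Qed.

Lemma fpsZE (x : k) a m : (x *: a) m = x * a m. Proof. by []. Qed.

Lemma fps_sumE (I : Type) (r : seq I) (P : pred I) (F : I -> fps k n) m :
  (\sum_(i <- r | P i) F i) m = \sum_(i <- r | P i) F i m.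
Proof. by elim/big_rec2: _ => // i x a _ <-. Qed.

Lemma fps_mul_def a b m : (a * b) m = fps_mul a b m. Proof. by []. Qed.

Lemma fps_scalerAl (x : k) a b : (x *: a) * b = x *: (a * b).
Proof.
apply/funext => m; rewrite fpsZE !fps_mul_def /fps_mul mulr_sumr.
by apply: eq_bigr => p _; rewrite fpsZE mulrA.
Qed.

Lemma fps_scalerAr (x : k) a b : a * (x *: b) = x *: (a * b).
Proof. by rewrite mulrC fps_scalerAl mulrC. Qed.

Definition fps_mon m : fps k n := fun m' => (m' == m)%:R.

Lemma fps_mon0 : fps_mon mnm0 = 1.
Proof.
apply/funext => m; rewrite /fps_mon.
by have -> : (1 : fps k n) m = fpsC 1 m by []; rewrite /fpsC; case: eqP.
Qed.

Lemma fps_monM m m' : fps_mon m * fps_mon m' = fps_mon (mnm_add m m').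
Proof.
apply/funext => mu; rewrite fps_mul_def.
rewrite (@fps_mulE _ _ _ _ (mpolyX k m) (mpolyX k m')).
- by rewrite -mpolyXD mcoeffX eq_sym.
- by move=> ? _; rewrite mcoeffX eq_sym.
- by move=> ? _; rewrite mcoeffX eq_sym.
Qed.

(** Membership in the d-th power of the maximal ideal, read on coefficients. *)
Definition ordge (d : nat) a := forall m, (mdeg m < d)%N -> a m = 0.

Lemma ordge_0 a : ordge 0 a. Proof. by []. Qed.

Lemma ordge0 d : ordge d 0. Proof. by []. Qed.

Lemma ordgeD d a b : ordge d a -> ordge d b -> ordge d (a + b).
Proof. by move=> ha hb m md; rewrite fpsDE ha// hb// addr0. Qed.

Lemma ordgeN d a : ordge d a -> ordge d (- a).
Proof. by move=> ha m md; rewrite fpsNE ha// oppr0. Qed.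

Lemma ordgeB d a b : ordge d a -> ordge d b -> ordge d (a - b).
Proof. by move=> ha hb; apply/ordgeD/ordgeN. Qed.

Lemma ordgeZ d (x : k) a : ordge d a -> ordge d (x *: a).
Proof. by move=> ha m md; rewrite fpsZE ha// mulr0. Qed.

Lemma ordge_sum d (I : Type) (r : seq I) (P : pred I) (F : I -> fps k n) :
  (forall i, P i -> ordge d (F i)) -> ordge d (\sum_(i <- r | P i) F i).
Proof. by move=> hF; apply: big_ind => //; exact: ordgeD. Qed.

Lemma ordgeM d d' a b : ordge d a -> ordge d' b -> ordge (d + d') (a * b).
Proof.
move=> ha hb m md; rewrite fps_mul_def /fps_mul big1// => p /eqP mE.
have [lt|le] := ltnP (mdeg (p.1 : multinom n)) d; first by rewrite ha// mul0r.
have /(congr1 mdeg) := mE; rewrite mdegD => E.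
rewrite hb ?mulr0// -(ltn_add2l d); apply: leq_ltn_trans md.
by rewrite [X in (_ <= X)%N]E leq_add2r.
Qed.

Lemma ordgeMl d a b : ordge d b -> ordge d (a * b).
Proof. exact: (@ordgeM 0). Qed.

Lemma ordge_exp d a j : ordge d a -> ordge (j * d) (a ^+ j).
Proof.
move=> ha; elim: j => [|j IH]; first exact: ordge_0.
by rewrite exprS mulSn; apply: ordgeM.
Qed.

Lemma ordge_fpsX i : ordge 1 (@fpsX k n i).
Proof.
move=> m; rewrite ltnS leqn0 mdeg_eq0 => /eqP ->.
by rewrite /fpsX eq_sym mnm1_eq0.
Qed.

(** The topology is separated. *)
Lemma ordge_eq a b : (forall d, ordge d (a - b)) -> a = b.
Proof.
move=> h; apply/funext => m; apply/eqP; rewrite -subr_eq0; apply/eqP.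
exact: (h (mdeg m).+1 m (ltnSn _)).
Qed.

Lemma fps_mon_expand d a :
  ordge d (a - \sum_(m : bmultinom n d) a m *: fps_mon m).
Proof.
move=> m md; rewrite fpsDE fpsNE fps_sumE (bigD1 (BMultinom md)) //=.
rewrite fpsZE /fps_mon eqxx mulr1 big1 ?addr0 ?subrr// => i ne.
rewrite fpsZE /fps_mon; case: eqP => [E|_]; last by rewrite mulr0.
by case/eqP: ne; apply: val_inj.
Qed.

(** The sum of a sequence of series whose orders tend to infinity: only the
    terms of index at most the degree of m contribute to the coefficient of m.
    *)
Definition fps_series (a : nat -> fps k n) : fps k n :=
  fun m => \sum_(i < (mdeg m).+1) a i m.

Lemma fps_series_partial (a : nat -> fps k n) d :
  (forall i, ordge i (a i)) -> ordge d (fps_series a - \sum_(i < d) a i).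
Proof.
move=> ha m md; rewrite fpsDE fpsNE fps_sumE /fps_series.
rewrite (big_ord_widen d (fun i => a i m) md).
rewrite [X in _ - X](bigID (fun i : 'I_d => i < (mdeg m).+1)%N) /=.
rewrite [X in _ - (_ + X)]big1 ?addr0 ?subrr// => i; rewrite -leqNgt => le.
exact: ha.
Qed.

(** Inversion by the geometric series. *)
Lemma fps_unit a : a mnm0 != 0 -> exists b, a * b = 1.
Proof.
move=> a0; pose u : fps k n := 1 - (a mnm0)^-1 *: a.
have hu : ordge 1 u.
  move=> m; rewrite ltnS leqn0 mdeg_eq0 => /eqP ->.
  by rewrite /u fpsDE fpsNE fpsZE mulVf// -fps_mon0 /fps_mon eqxx subrr.
have hU i : ordge i (u ^+ i) by rewrite -[X in ordge X]muln1; apply: ordge_exp.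
have E : (1 - u) * fps_series (fun i => u ^+ i) = 1.
  apply: ordge_eq => d.
  have -> : (1 - u) * fps_series (fun i => u ^+ i) - 1 =
      (1 - u) * (fps_series (fun i => u ^+ i) - \sum_(i < d) u ^+ i) - u ^+ d.
    have H : (1 - u) * (\sum_(i < d) u ^+ i) = 1 - u ^+ d.
      by rewrite -opprB mulNr -subrX1 opprB.
    by rewrite mulrBr H -addrA -opprD subrK.
  by apply: ordgeB; [apply/ordgeMl/fps_series_partial | exact: hU].
exists ((a mnm0)^-1 *: fps_series (fun i => u ^+ i)).
by rewrite fps_scalerAr -fps_scalerAl -[RHS]E /u opprB addrCA subrr addr0.
Qed.

(** Division of a series without constant term by the variables; each monomial
    is assigned to the first variable that divides it. *)
Definition fps_quo (i : 'I_n) a : fps k n := fun m =>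
  if [forall j : 'I_n, (j < i)%N ==> (m j == 0%N)] then a (mnm_add m (mnm1 i))
  else 0.

Lemma fps_XmulE i a m :
  (fpsX k i * a) m = if (m i == 0)%N then 0 else a (mnm_sub m (mnm1 i)).
Proof.
pose p := fps_trunc (mdeg m).+1 a.
rewrite fps_mul_def (@fps_mulE _ _ _ _ (mpolyX k (mnm1 i)) p); first last.
- by move=> m' le; apply: fps_truncE; rewrite ltnS.
- by move=> m' _; rewrite mcoeffX eq_sym.
rewrite mulrC; case: eqP => [mi|/eqP mi].
  rewrite mcoeffMr big1// => -[m1 m2] /= /eqP mE; rewrite mcoeffX.
  case: eqP => [E|_]; last by rewrite mulr0.
  have /(congr1 (fun m' : multinom n => m' i)) := mE.
  by rewrite [LHS]mi -E mnmDE mnm1E eqxx.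
have {1}-> : m = mnm_add (mnm1 i) (mnm_sub m (mnm1 i)).
  apply/mnmP => j; rewrite mnmDE mnmBE mnm1E subnKC//.
  by case: eqP => // <-; rewrite lt0n.
rewrite mcoeffMX -fps_truncE// ltnS; exact: mdegB.
Qed.

Lemma ordge_quo d a i : ordge d.+1 a -> ordge d (fps_quo i a).
Proof.
move=> ha m md; rewrite /fps_quo; case: ifP => // _; apply: ha.
by rewrite mdegD mdeg1 addn1 ltnS.
Qed.

Lemma fps_quoE a : a mnm0 = 0 -> a = \sum_(i < n) fpsX k i * fps_quo i a.
Proof.
move=> a0; apply/funext => m; rewrite fps_sumE.
have [->|m0] := eqVneq m mnm0.
  by rewrite a0 big1// => i _; rewrite fps_XmulE mnm0E.
have [i0 mi0] : exists i, m i != 0%N.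
  apply/existsP; rewrite -negb_forall; apply: contra m0 => /forallP h.
  by apply/eqP/mnmP => i; rewrite mnm0E; apply/eqP.
have [i mi imin] := @arg_minnP _ i0 (fun i => m i != 0%N) (@nat_of_ord n) mi0.
have E1 : mnm_add (mnm_sub m (mnm1 i)) (mnm1 i) = m.
  apply/mnmP => j; rewrite mnmDE mnmBE mnm1E subnK//.
  by case: eqP => // <-; rewrite lt0n.
have lt0 (j : 'I_n) : (j < i)%N -> m j = 0%N.
  move=> ji; apply/eqP; apply: contraTT ji => mj; rewrite -leqNgt.
  exact: imin.
rewrite (bigD1 i)//= fps_XmulE (negPf mi) /fps_quo E1 ifT.
  rewrite big1 ?addr0// => j ji; rewrite fps_XmulE; case: eqP => // /eqP mj.
  have ij : (i < j)%N by rewrite ltn_neqAle eq_sym ji imin.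
  rewrite /fps_quo ifF//; apply/negbTE/forallPn; exists i.
  by rewrite ij /= mnmBE mnm1E (negPf ji) subn0.
by apply/forallP => j; apply/implyP => ji; rewrite mnmBE lt0.
Qed.

End Coefficients.

Arguments fps_mon {k n} m.

(** * Substitution as a ring morphism *)

Section Substitution.
Variables (k : fieldType) (p n : nat).

(** A continuous linear map is determined by its values on monomials. *)
Lemma fps_lin_eq0 (L : fps k p -> fps k n) :
  (forall a b, L (a + b) = L a + L b) ->
  (forall (x : k) a, L (x *: a) = x *: L a) ->
  (forall d a, ordge d a -> ordge d (L a)) ->
  (forall m, L (fps_mon m) = 0) -> forall a, L a = 0.
Proof.
move=> LD LZ Lc Lm a; apply: ordge_eq => d; rewrite subr0.
rewrite -[a](subrK (\sum_(m : bmultinom p d) a m *: fps_mon m)) LD.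
apply: ordgeD; first exact/Lc/fps_mon_expand.
elim/big_rec: _ => [|m b _ IH].
  by rewrite -(scale0r 0) LZ scale0r; exact: ordge0.
by rewrite LD LZ Lm scaler0 add0r.
Qed.

Variable f : 'I_p -> fps k n.

Definition fps_pow (m : multinom p) : fps k n := \prod_(i < p) f i ^+ m i.

Lemma fps_powD m m' : fps_pow (mnm_add m m') = fps_pow m * fps_pow m'.
Proof.
rewrite /fps_pow -big_split; apply: eq_bigr => i _ /=.
by rewrite mnmDE exprD.
Qed.

Lemma fps_pow0 : fps_pow mnm0 = 1.
Proof. by rewrite /fps_pow big1// => i _; rewrite mnm0E expr0. Qed.

Lemma fps_pow1 i : fps_pow (mnm1 i) = f i.
Proof.
rewrite /fps_pow (bigD1 i)//= mnm1E eqxx expr1 big1 ?mulr1// => j ji.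
by rewrite mnm1E eq_sym (negPf ji) expr0.
Qed.

Lemma fps_substD a b : fps_subst f (a + b) = fps_subst f a + fps_subst f b.
Proof.
apply/funext => mu; rewrite fpsDE /fps_subst -big_split.
by apply: eq_bigr => m _; rewrite fpsDE mulrDl.
Qed.

Lemma fps_subst0 : fps_subst f 0 = 0.
Proof. by apply: (addrI (fps_subst f 0)); rewrite -fps_substD !addr0. Qed.

Lemma fps_subst_sum (I : Type) (r : seq I) (P : pred I) (F : I -> fps k p) :
  fps_subst f (\sum_(i <- r | P i) F i) =
  \sum_(i <- r | P i) fps_subst f (F i).
Proof. exact: (big_morph _ fps_substD fps_subst0). Qed.

Lemma fps_substZ (x : k) a : fps_subst f (x *: a) = x *: fps_subst f a.
Proof.
apply/funext => mu; rewrite fpsZE /fps_subst mulr_sumr.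
by apply: eq_bigr => m _; rewrite fpsZE mulrA.
Qed.

Lemma fps_substB : {morph fps_subst f : a b / a - b}.
Proof.
move=> a b; rewrite fps_substD; congr (_ + _).
by rewrite -scaleN1r fps_substZ scaleN1r.
Qed.

Lemma ordge_subst d a : ordge d a -> ordge d (fps_subst f a).
Proof.
move=> ha mu md; rewrite /fps_subst big1// => m _; rewrite ha ?mul0r//.
by apply: leq_trans md; apply: bmdeg.
Qed.

Hypothesis hf : forall i, ordge 1 (f i).

Lemma ordge_pow m : ordge (mdeg m) (fps_pow m).
Proof.
rewrite mdegE /fps_pow.
elim/big_rec2: _ => [|i d a _ IH]; first exact: ordge_0.
by apply: ordgeM => //; rewrite -{1}[m i]muln1; apply: ordge_exp.
Qed.

Lemma fps_subst_mon m : fps_subst f (fps_mon m) = fps_pow m.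
Proof.
apply/funext => mu; rewrite /fps_subst.
have [lt|le] := ltnP (mdeg mu) (mdeg m).
  rewrite (ordge_pow lt) big1// => i _; rewrite /fps_mon.
  case: eqP => [E|_]; last by rewrite mul0r.
  have := bmdeg i; rewrite ltnS => /leq_ltn_trans/(_ lt).
  by rewrite [bmnm i]E ltnn.
have lt : (mdeg m < (mdeg mu).+1)%N by rewrite ltnS.
rewrite (bigD1 (BMultinom lt))//= -/(fps_pow m) /fps_mon eqxx mul1r.
rewrite big1 ?addr0// => i ne; case: eqP => [E|_]; last by rewrite mul0r.
by case/eqP: ne; apply: val_inj.
Qed.

(** Both sides are continuous and linear in each factor, so that only products
    of monomials have to be compared. *)
Lemma fps_substM a b : fps_subst f (a * b) = fps_subst f a * fps_subst f b.
Proof.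
apply/eqP; rewrite -subr_eq0; apply/eqP.
pose L1 (m : multinom p) (b : fps k p) :=
  fps_subst f (fps_mon m * b) - fps_pow m * fps_subst f b.
pose L2 (a : fps k p) := fps_subst f (a * b) - fps_subst f a * fps_subst f b.
rewrite -/(L2 a); apply: fps_lin_eq0 => {a}.
- move=> a c; rewrite /L2 !(mulrDl, fps_substD).
  by rewrite opprD addrACA.
- move=> x a; rewrite /L2 !(fps_scalerAl, fps_substZ).
  by rewrite scalerBr.
- move=> d a ha; apply: ordgeB.
    by apply: ordge_subst; rewrite mulrC; apply: ordgeMl.
  by rewrite mulrC; apply/ordgeMl/ordge_subst.
move=> m; rewrite /L2 fps_subst_mon -/(L1 m b); apply: fps_lin_eq0 => {b L2}.
- move=> a c; rewrite /L1 !(mulrDr, fps_substD).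
  by rewrite opprD addrACA.
- move=> x a; rewrite /L1 !(fps_scalerAr, fps_substZ).
  by rewrite scalerBr.
- move=> d a ha; apply: ordgeB; first exact/ordge_subst/ordgeMl.
  exact/ordgeMl/ordge_subst.
by move=> m'; rewrite /L1 fps_monM !fps_subst_mon fps_powD subrr.
Qed.

Lemma fps_subst1 : fps_subst f 1 = 1.
Proof. by rewrite -fps_mon0 fps_subst_mon fps_pow0. Qed.

Definition fps_subst_rmorphism : {rmorphism fps k p -> fps k n} :=
  HB.pack (fps_subst f)
    (GRing.isZmodMorphism.Build _ _ (fps_subst f) fps_substB)
    (GRing.isMonoidMorphism.Build _ _ (fps_subst f) (fps_subst1, fps_substM)).

Lemma fps_substX i : fps_subst f (fpsX k i) = f i.
Proof. by rewrite [fpsX k i]/(fps_mon (mnm1 i)) fps_subst_mon fps_pow1. Qed.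

End Substitution.

(** * Finitely generated ideals and their powers *)

Section IdealLemmas.
Variable A : comNzRingType.
Implicit Types (S : set A) (x y a : A).

Section Span.
Variables (r : nat) (h : 'I_r -> A).

(** The ideal of a finite family, with one coefficient for each generator
    instead of a list of pairs. *)
Definition span x : Prop := exists c : 'I_r -> A, x = \sum_(i < r) h i * c i.

Lemma span0 : span 0.
Proof. by exists (fun=> 0); rewrite big1// => i _; rewrite mulr0. Qed.

Lemma spanD x y : span x -> span y -> span (x + y).
Proof.
move=> [c ->] [d ->]; exists (fun i => c i + d i).
by rewrite -big_split; apply: eq_bigr => i _; rewrite mulrDr.
Qed.

Lemma spanMl a x : span x -> span (a * x).
Proof.
move=> [c ->]; exists (fun i => a * c i).
by rewrite mulr_sumr; apply: eq_bigr => i _; rewrite mulrCA.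
Qed.

Lemma spanMr a x : span x -> span (x * a).
Proof. by rewrite mulrC; apply: spanMl. Qed.

Lemma spanB x y : span x -> span y -> span (x - y).
Proof. by move=> hx hy; rewrite -mulN1r; apply/spanD/spanMl. Qed.

Lemma span_gen i : span (h i).
Proof.
exists (fun j => (j == i)%:R); rewrite (bigD1 i)//= eqxx mulr1 big1 ?addr0//.
by move=> j /negPf ->; rewrite mulr0.
Qed.

Lemma span_sum (I : Type) (s : seq I) (P : pred I) (F : I -> A) :
  (forall i, P i -> span (F i)) -> span (\sum_(i <- s | P i) F i).
Proof. by move=> hF; apply: big_ind => //; [exact: span0 | exact: spanD]. Qed.

Lemma ideal_gen_spanE S :
  (forall i, S (h i) \/ h i = 0) -> (forall x, S x -> exists i, x = h i) ->
  forall x, ideal_gen S x <-> span x.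
Proof.
move=> hS Sh x; split=> [[s [sS ->]]|[c ->]].
  rewrite big_seq; apply: span_sum => q /sS/Sh[i ->].
  exact/spanMl/span_gen.
exists [seq (c i, h i) | i <- enum 'I_r & `[< S (h i) >]]; split=> [q|].
  by move=> /mapP[i]; rewrite mem_filter => /andP[/asboolP ? _] ->.
rewrite big_map big_filter big_enum_cond /=.
rewrite [RHS]big_mkcond /=; apply: eq_bigr => i _.
case: ifP => [_|/negbT/asboolPn nS]; first exact: mulrC.
by case: (hS i) => // ->; rewrite mul0r.
Qed.

End Span.

Lemma ideal_gen_rangeE r (h : 'I_r -> A) x : ideal_gen (range h) x <-> span h x.
Proof.
apply: ideal_gen_spanE => [i|y [i _ <-]]; first by left; exists i.
by exists i.
Qed.

(** The generators of the ideal of the first i terms of a sequence, padded with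
    zeros so that all these ideals have the same indexing type. *)
Definition firsts r (h : 'I_r -> A) (i : nat) : 'I_r -> A :=
  fun j => if (j < i)%N then h j else 0.

Lemma ideal_gen_firstsE r (h : 'I_r -> A) (i : nat) x :
  ideal_gen [set h j | j in [set j : 'I_r | (j < i)%N]] x <->
  span (firsts h i) x.
Proof.
apply: ideal_gen_spanE => [j|y [j /= ji <-]]; last first.
  by exists j; rewrite /firsts ji.
by rewrite /firsts; case: ifP => ji; [left; exists j | right].
Qed.

Lemma ideal_gen_closed S : [/\ ideal_gen S 0,
  forall x y, ideal_gen S x -> ideal_gen S y -> ideal_gen S (x + y) &
  forall a x, ideal_gen S x -> ideal_gen S (a * x)].
Proof.
split.
- by exists [::]; split=> //; rewrite big_nil.
- move=> _ _ [s [sS ->]] [t [tS ->]]; exists (s ++ t); split; last first.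
    by rewrite big_cat.
  by move=> q; rewrite mem_cat => /orP[/sS|/tS].
- move=> a _ [s [sS ->]]; exists [seq (a * q.1, q.2) | q <- s]; split.
    by move=> _ /mapP[q /sS ? ->].
  by rewrite big_map mulr_sumr; apply: eq_bigr => q _; rewrite mulrA.
Qed.

Variables (p : nat) (z : 'I_p -> A).
Let I := ideal_gen (range z).

Lemma ideal_exp_closed m : [/\ ideal_exp I m 0,
  forall x y, ideal_exp I m x -> ideal_exp I m y -> ideal_exp I m (x + y) &
  forall a x, ideal_exp I m x -> ideal_exp I m (a * x)].
Proof. by case: m => [|m]; [split | exact: ideal_gen_closed]. Qed.

Lemma ideal_exp0 m : ideal_exp I m 0.
Proof. by case: (ideal_exp_closed m). Qed.

Lemma ideal_expD m x y :
  ideal_exp I m x -> ideal_exp I m y -> ideal_exp I m (x + y).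
Proof. by case: (ideal_exp_closed m) => _ + _; apply. Qed.

Lemma ideal_expMl m a x : ideal_exp I m x -> ideal_exp I m (a * x).
Proof. by case: (ideal_exp_closed m) => _ _; apply. Qed.

Lemma ideal_exp_sum m (T : Type) (s : seq T) (P : pred T) (F : T -> A) :
  (forall i, P i -> ideal_exp I m (F i)) ->
  ideal_exp I m (\sum_(i <- s | P i) F i).
Proof.
by move=> hF; apply: big_ind => //; [exact: ideal_exp0 | exact: ideal_expD].
Qed.

(** In the successor power one generator can be factored out at a time, with
    cofactors in the previous power: this recursion replaces expansions in
    monomials of degree m. *)
Lemma ideal_expSE m x : ideal_exp I m.+1 x <->
  exists2 y : 'I_p -> A,
    forall i, ideal_exp I m (y i) & x = \sum_(i < p) z i * y i.
Proof.
split; last first.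
  move=> [y hy ->]; exists [seq (1, z i * y i) | i <- enum 'I_p]; split.
    move=> _ /mapP[i _ ->] /=; exists (z i); last by exists (y i).
    by apply/ideal_gen_rangeE; exact: span_gen.
  by rewrite big_map big_enum /=; apply: eq_bigr => i _; rewrite mul1r.
move=> [s [sS ->]].
elim: s sS => [|[a w] s IH] sS.
  exists (fun=> 0); first by move=> i; exact: ideal_exp0.
  by rewrite big_nil big1// => i _; rewrite mulr0.
have [q qs|y hy E] := IH; first by apply: sS; rewrite inE qs orbT.
have /= [_ /ideal_gen_rangeE[c ->] [v hv <-]] := sS _ (mem_head _ _).
exists (fun i => a * c i * v + y i).
  by move=> i; apply: ideal_expD => //; apply: ideal_expMl.
rewrite big_cons E mulr_suml mulr_sumr -big_split; apply: eq_bigr => i _ /=.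
by rewrite mulrDr -!mulrA [a * _]mulrCA.
Qed.

Lemma ideal_exp_leq m m' x : (m <= m')%N -> ideal_exp I m' x -> ideal_exp I m x.
Proof.
elim: m m' x => // m IH [//|m'] x; rewrite ltnS => le /ideal_expSE[y hy ->].
by apply/ideal_expSE; exists y => // i; exact: IH le (hy i).
Qed.

Lemma ideal_expMD m m' x y :
  ideal_exp I m x -> ideal_exp I m' y -> ideal_exp I (m + m') (x * y).
Proof.
elim: m x => [|m IH] x; first by move=> _ hy; apply: ideal_expMl.
move=> /ideal_expSE[c hc ->] hy; rewrite addSn; apply/ideal_expSE.
exists (fun i => c i * y) => [i|]; first exact: IH.
by rewrite mulr_suml; apply: eq_bigr => i _; rewrite mulrA.
Qed.

End IdealLemmas.

Section IdealsOfSeries.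
Variables (k : fieldType) (n : nat).

Lemma ideal_exp_ordge p (z : 'I_p -> fps k n) m x :
  (forall i, ordge 1 (z i)) -> ideal_exp (ideal_gen (range z)) m x -> ordge m x.
Proof.
move=> hz; elim: m x => [|m IH] x; first by move=> _; exact: ordge_0.
move=> /ideal_expSE[y hy ->]; apply: ordge_sum => i _; rewrite -add1n.
by apply: ordgeM => //; exact: IH.
Qed.

Lemma max_ideal_expE m (x : fps k n) :
  ideal_exp (max_ideal k n) m x <-> ordge m x.
Proof.
split; first by apply: ideal_exp_ordge => i; exact: ordge_fpsX.
elim: m x => [//|m IH] x hx; apply/ideal_expSE.
exists (fun i => fps_quo i x) => [i|]; first exact/IH/ordge_quo.
by apply: fps_quoE; rewrite hx// mdeg0.
Qed.

Lemma max_idealE (x : fps k n) : max_ideal k n x <-> ordge 1 x.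
Proof.
rewrite -max_ideal_expE /max_ideal ideal_gen_rangeE; split=> [[c ->]|].
  by apply/ideal_expSE; exists c.
by move=> /ideal_expSE[c _ ->]; exists c.
Qed.

End IdealsOfSeries.

(** * Nakayama's lemma over a power series ring *)

Section CompleteNakayama.
Variables (k : fieldType) (n p r s : nat).
Variables (z : 'I_p -> fps k n) (h : 'I_r -> fps k n) (b : 'I_s -> fps k n).
Hypothesis hz : forall i, ordge 1 (z i).

Local Notation phi := (fps_subst z).
Let I := ideal_gen (range z).

Hypothesis spanning : forall x, exists c : 'I_s -> k,
  exists u : 'I_p -> fps k n, exists v : 'I_r -> fps k n,
  x = \sum_j c j *: b j + \sum_i z i * u i + \sum_l h l * v l.

(** One step of the expansion: the part of x that lies in the next power of the
    ideal of z is the remainder y. Writing x as a combination of the z i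
    reduces degree m + 1 to degree m. *)
Lemma nakayama_step m x : ideal_exp I m x ->
  exists C : 'I_s -> fps k p, exists v : 'I_r -> fps k n, exists y,
  [/\ forall j, ordge m (C j), forall l, ordge m (v l), ideal_exp I m.+1 y &
      x = \sum_j phi (C j) * b j + \sum_l h l * v l + y].
Proof.
elim: m x => [|m IH] x.
  move=> _; have [c [u [v ->]]] := spanning x.
  exists (fun j => c j *: (1 : fps k p)), v, (\sum_i z i * u i); split=> //.
  - by apply/ideal_expSE; exists u.
  - rewrite addrAC; congr (_ + _ + _); apply: eq_bigr => j _.
    have -> : phi (c j *: (1 : fps k p)) = c j *: (1 : fps k n).
      by rewrite fps_substZ fps_subst1.
    by rewrite fps_scalerAl mul1r.
move=> /ideal_expSE[w hw ->].
have /choice[C /choice[v /choice[y H]]] := fun i => IH _ (hw i).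
exists (fun j => \sum_i fpsX k i * C i j), (fun l => \sum_i z i * v i l).
exists (\sum_i z i * y i); split.
- move=> j; apply: ordge_sum => i _; rewrite -add1n.
  by apply: ordgeM; [exact: ordge_fpsX | case: (H i)].
- move=> l; apply: ordge_sum => i _; rewrite -add1n.
  by apply: ordgeM => //; case: (H i).
- by apply/ideal_expSE; exists y => // i; case: (H i).
rewrite (eq_bigr (fun i => \sum_j z i * (phi (C i j) * b j) +
   \sum_l z i * (h l * v i l) + z i * y i)); last first.
  by move=> i _; case: (H i) => _ _ _ {1}->; rewrite !mulrDr !mulr_sumr.
rewrite !big_split /=; congr (_ + _ + _).
- rewrite exchange_big; apply: eq_bigr => j _ /=.
  rewrite fps_subst_sum mulr_suml; apply: eq_bigr => i _.
  by rewrite fps_substM// fps_substX// mulrA.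
- rewrite exchange_big; apply: eq_bigr => l _ /=.
  by rewrite mulr_sumr; apply: eq_bigr => i _; rewrite mulrCA.
Qed.

(** Nakayama's lemma over a complete base: a family that spans modulo the
    parameters z generates over the power series in z. The expansion of x is
    the limit of the successive expansions of the remainders, the m-th of which
    lies in the m-th power of the ideal of z. *)
Lemma complete_nakayama x : exists C : 'I_s -> fps k p,
  exists v : 'I_r -> fps k n,
  x = \sum_j fps_subst z (C j) * b j + \sum_l h l * v l.
Proof.
have /choice[C] (t : nat * fps k n) : exists C : 'I_s -> fps k p,
    exists v : 'I_r -> fps k n, exists y, ideal_exp I t.1 t.2 ->
  [/\ forall j, ordge t.1 (C j), forall l, ordge t.1 (v l),
      ideal_exp I t.1.+1 y &
      t.2 = \sum_j phi (C j) * b j + \sum_l h l * v l + y].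
  have [/nakayama_step[C [v [y H]]]|nI] := pselect (ideal_exp I t.1 t.2).
    by exists C, v, y.
  by exists (fun=> 0), (fun=> 0), 0.
move=> /choice[v] /choice[y] H.
(* The successive remainders X, and the terms D and w that they contribute. *)
pose X := fix X m := if m is m'.+1 then y (m', X m') else x.
have XI m : ideal_exp I m (X m).
  by elim: m => // m IH; case: (H (m, X m) IH).
pose D m := C (m, X m); pose w m := v (m, X m).
have hD j m : ordge m (D m j).
  by case: (H (m, X m) (XI m)) => + _ _ _; apply.
have hw l m : ordge m (w m l).
  by case: (H (m, X m) (XI m)) => _ + _ _; apply.
exists (fun j => fps_series (fun m => D m j)).
exists (fun l => fps_series (fun m => w m l)).
apply: ordge_eq => d.
have E : x = \sum_j phi (\sum_(m < d) D m j) * b j +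
             \sum_l h l * (\sum_(m < d) w m l) + X d.
  elim: d => [|d IH].
    rewrite !big1 ?add0r// => i _; rewrite big_ord0 ?mulr0//.
    by rewrite fps_subst0 mul0r.
  have E1 : \sum_j phi (\sum_(m < d.+1) D m j) * b j =
      \sum_j phi (\sum_(m < d) D m j) * b j + \sum_j phi (D d j) * b j.
    rewrite -big_split; apply: eq_bigr => j _.
    by rewrite big_ord_recr fps_substD mulrDl.
  have E2 : \sum_l h l * (\sum_(m < d.+1) w m l) =
      \sum_l h l * (\sum_(m < d) w m l) + \sum_l h l * w d l.
    rewrite -big_split; apply: eq_bigr => l _.
    by rewrite big_ord_recr mulrDr.
  have [_ _ _ /= E3] := H (d, X d) (XI d).
  rewrite E1 E2 [LHS]IH [X in _ + X = _]E3 addrA; congr (_ + _).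
  exact: addrACA.
rewrite {1}E addrAC opprD addrACA -!sumrB; apply: ordgeD; last first.
  exact: (ideal_exp_ordge hz (XI d)).
apply: ordgeD; apply: ordge_sum => i _.
  rewrite -mulrBl mulrC -fps_substB -opprB; apply/ordgeMl/ordge_subst/ordgeN.
  exact: fps_series_partial.
by rewrite -mulrBr -opprB; apply/ordgeMl/ordgeN/fps_series_partial.
Qed.

End CompleteNakayama.

(** * Leading forms and generic linear changes of variables *)

Section LeadingForm.
Variables (k : fieldType) (n : nat).
Implicit Types (a b : fps k n) (m : multinom n).

Definition lform (d : nat) a : mpoly n k :=
  \sum_(m : bmultinom n d.+1 | mdeg m == d) a m *: mpolyX k m.

Lemma lformE d a m : mcoeff m (lform d a) = if mdeg m == d then a m else 0.
Proof.
rewrite /lform raddf_sum /=; case: eqP => [md|md].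
  have lt : (mdeg m < d.+1)%N by rewrite md.
  rewrite (bigD1 (BMultinom lt)) ?md//= mcoeffZ mcoeffX eqxx mulr1.
  rewrite big1 ?addr0// => i /andP[_ ne]; rewrite mcoeffZ mcoeffX.
  case: eqP => [E|_]; last by rewrite mulr0.
  by case/eqP: ne; apply: val_inj.
rewrite big1// => i /eqP id; rewrite mcoeffZ mcoeffX.
by case: eqP => [E|_]; rewrite ?mulr0//; case: md; rewrite -E.
Qed.

Lemma lformD d a b : lform d (a + b) = lform d a + lform d b.
Proof.
apply/mpolyP => m; rewrite mcoeffD !lformE.
by case: ifP => _; rewrite ?fpsDE ?addr0.
Qed.

Lemma lform_sum d (I : Type) (r : seq I) (F : I -> fps k n) :
  lform d (\sum_(i <- r) F i) = \sum_(i <- r) lform d (F i).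
Proof.
elim: r => [|i r IH]; last by rewrite !big_cons lformD IH.
by rewrite !big_nil; apply/mpolyP => m; rewrite lformE mcoeff0 if_same.
Qed.

(** The graded ring of the power series ring is the polynomial ring. *)
Lemma lformM d d' a b : ordge d a -> ordge d' b ->
  lform (d + d') (a * b) = lform d a * lform d' b.
Proof.
move=> ha hb; apply/mpolyP => m; rewrite lformE mcoeffM; case: eqP => md.
  rewrite fps_mul_def /fps_mul; apply: eq_bigr => -[m1 m2] /= /eqP/(congr1 mdeg).
  rewrite mdegD !lformE => E0; have E := etrans (esym E0) md.
  case: (ltngtP (mdeg m1) d) => [lt|gt|e1].
  - by rewrite ha// !mul0r.
  - rewrite mul0r hb ?mulr0//.
    by rewrite -(ltn_add2l d) -E ltn_add2r.
  - have e2 : mdeg m2 = d' by apply/eqP; rewrite -(eqn_add2l d) -E e1.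
    by rewrite e2 eqxx.
rewrite big1// => -[m1 m2] /= /eqP/(congr1 mdeg); rewrite mdegD !lformE => E.
case: eqP => [e1|_]; last by rewrite mul0r.
case: eqP => [e2|_]; last by rewrite mulr0.
by case: md; rewrite E e1 e2.
Qed.

Lemma lform_neq0 d a m : mdeg m = d -> a m != 0 -> lform d a != 0.
Proof.
move=> md; apply: contraNneq => /(congr1 (mcoeff m)).
by rewrite lformE md eqxx mcoeff0 => ->.
Qed.

Lemma lform_eq0 d a : lform d a != 0 -> exists2 m, mdeg m = d & a m != 0.
Proof.
move=> /mlead_supp; rewrite mcoeff_msupp lformE.
case: ifP => [/eqP md am|_]; last by rewrite eqxx.
by exists (mlead (lform d a)).
Qed.

Lemma fps_exact_order a : a != 0 -> exists2 d, ordge d a & lform d a != 0.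
Proof.
move=> a0; have [m am] : exists m, a m != 0.
  apply: contrapT => /forallNP h; case/eqP: a0; apply/funext => m.
  by apply/eqP/negPn/negP; exact: h.
have ex : exists d, `[< exists2 m, mdeg m = d & a m != 0 >].
  by exists (mdeg m); apply/asboolP; exists m.
have [d /asboolP[m0 m0d am0] hmin] := ex_minnP ex.
eexists; last exact: lform_neq0 m0d am0.
move=> m' lt; apply/eqP; apply: contraTT lt => am'; rewrite -leqNgt.
by apply: hmin; apply/asboolP; exists m'.
Qed.

End LeadingForm.

Section NonVanishing.

Lemma base_expansion_inj (B n : nat) (u v : 'I_n -> nat) :
  (forall i, u i < B)%N -> (forall i, v i < B)%N ->
  (\sum_(i < n) u i * B ^ i = \sum_(i < n) v i * B ^ i)%N -> u =1 v.
Proof.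
elim: n u v => [|n IH] u v hu hv; first by move=> _ [].
have E (w : 'I_n.+1 -> nat) : (\sum_(i < n.+1) w i * B ^ i =
    (\sum_(i < n) w (lift ord0 i) * B ^ i) * B + w ord0)%N.
  rewrite big_ord_recl expn0 muln1 addnC big_distrl; congr (_ + _)%N.
  by apply: eq_bigr => i _; rewrite expnSr mulnA.
have B0 : (0 < B)%N by apply: leq_ltn_trans (hu ord0).
rewrite !E => H.
have H0 : u ord0 = v ord0.
  by have := congr1 (modn^~ B) H; rewrite !modnMDl !modn_small.
have H1 : u \o lift ord0 =1 v \o lift ord0.
  apply: IH => [i|i|]; [exact: hu | exact: hv |].
  by have := congr1 (divn^~ B) H; rewrite !divnMDl// !divn_small// !addn0.
move=> i; case: (unliftP ord0 i) => [j ->|->//]; exact: H1.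
Qed.

Variables (k : fieldType) (n : nat).
Hypothesis k0 : [pchar k] =i pred0.

(** Kronecker substitution: along the curve t |-> (t^(B^i))_i the monomials of
    degree less than B take distinct exponents. *)
Lemma mpoly_nonvanishing (P : mpoly n k) : P != 0 ->
  exists2 l : 'I_n -> k, forall i, l i != 0 & meval l P != 0.
Proof.
move=> P0; pose B := msize P.
pose enc (m : multinom n) := (\sum_(i < n) m i * B ^ i)%N.
pose q : {poly k} := \sum_(m <- msupp P) mcoeff m P *: 'X^(enc m).
have bnd m i : m \in msupp P -> (m i < B)%N.
  move=> /msize_mdeg_lt; apply: leq_ltn_trans.
  by rewrite mdegE (bigD1 i)//= leq_addr.
have q0 : q != 0.
  have ms := mlead_supp P0.
  apply/eqP => /(congr1 (fun p : {poly k} => p`_(enc (mlead P)))).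
  rewrite coef0 /q coef_sum (bigD1_seq (mlead P)) ?msupp_uniq//=.
  rewrite coefZ coefXn eqxx mulr1 big1_seq ?addr0; last first.
    move=> m /andP[ne mP]; rewrite coefZ coefXn; case: eqP => [E|_]; last first.
      by rewrite mulr0.
    case/eqP: ne; apply/mnmP/(base_expansion_inj (B := B)) => [i|i|].
    - exact: bnd.
    - exact: bnd.
    - by rewrite -/(enc _) -/(enc _) E.
  by apply/eqP; rewrite -mcoeff_msupp.
(* A field of characteristic zero is infinite. The factor 'X excludes t = 0, and
   hence zero coordinates. *)
have [t tr] : exists t, ~~ root (q * 'X) t.
  apply: contrapT => /forallNP h.
  have qX0 : q * 'X != 0 by rewrite mulf_neq0 ?polyX_eq0.
  pose s : seq k := [seq i%:R | i <- iota 0 (size (q * 'X))].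
  have rs : all (root (q * 'X)) s.
    by apply/allP => t _; apply: contrapT => /negP; exact: h.
  have us : uniq s.
    rewrite map_inj_uniq ?iota_uniq// => i j E; apply/eqP.
    wlog ij : i j E / (i <= j)%N.
      move=> H; case/orP: (leq_total i j) => le; first exact: H.
      by rewrite eq_sym; exact: H.
    rewrite eqn_leq ij -subn_eq0 -(iffLR (pcharf0P _) k0) natrB// E subrr.
    exact: eqxx.
  by have := max_poly_roots qX0 rs us; rewrite size_map size_iota ltnn.
rewrite rootM negb_or rootX in tr; case/andP: tr => tq t0.
exists (fun i => t ^+ (B ^ i)) => [i|]; first by rewrite expf_eq0 (negPf t0) andbF.
apply: contraNneq tq => E; rewrite /root -[X in _ == X]E mevalE /q horner_sum.
apply/eqP/eq_bigr => m _; rewrite hornerZ hornerXn; congr (_ * _).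
rewrite /enc (big_morph _ (exprD t) (expr0 t)); apply: eq_bigr => i _.
by rewrite mulnC exprM.
Qed.

End NonVanishing.

Section LinearChange.
Variables (k : fieldType) (d : nat) (l : 'I_d.+1 -> k).

(** When l ord0 is nonzero, the common zeros of these forms are the multiples
    of l. *)
Definition elim_params : 'I_d -> fps k d.+1 := fun j =>
  l ord0 *: fpsX k (lift ord0 j) - l (lift ord0 j) *: fpsX k ord0.

(** Modulo these forms the variable of index i times l ord0 is the first
    variable times l i. So a series of order at least q becomes, after
    multiplication by l ord0 ^+ q, the q-th power of the first variable times a
    series w, whose constant term is the value at l of the leading form. *)
Lemma elim_params_lead q (a : fps k d.+1) : ordge q a -> exists w : fps k d.+1,
  span elim_params (l ord0 ^+ q *: a - fpsX k ord0 ^+ q * w) /\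
  w mnm0 = meval l (lform q a).
Proof.
elim: q a => [|q IH] a ha.
  exists a; rewrite !expr0 scale1r mul1r subrr; split; first exact: span0.
  have -> : lform 0 a = mpolyC _ (a mnm0).
    apply/mpolyP => m; rewrite lformE mcoeffC mdeg_eq0.
    by case: eqP => [->|_]; rewrite ?mulr1// mulr0.
  by rewrite mevalC.
have aE : a = \sum_(i < d.+1) fpsX k i * fps_quo i a.
  by apply: fps_quoE; rewrite ha// mdeg0.
have hq i := ordge_quo i ha.
have /choice[w hw] := fun i => IH _ (hq i).
exists (\sum_i l i *: w i); split; last first.
  rewrite fps_sumE {1}aE lform_sum rmorph_sum; apply: eq_bigr => i _ /=.
  rewrite fpsZE (hw i).2 -[q.+1]add1n lformM//; last exact: ordge_fpsX.
  rewrite rmorphM /=; congr (_ * _).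
  have -> : lform 1 (fpsX k i) = mpolyX k (mnm1 i); last by rewrite mevalXU.
  apply/mpolyP => m; rewrite lformE mcoeffX /fpsX [mnm1 i == m]eq_sym.
  by case: (eqVneq m (mnm1 i)) => [->|_]; rewrite ?mdeg1 ?if_same.
rewrite {1}aE scaler_sumr mulr_sumr -sumrB; apply: span_sum => i _.
have -> : l ord0 ^+ q.+1 *: (fpsX k i * fps_quo i a) -
    fpsX k ord0 ^+ q.+1 * (l i *: w i) =
    (l ord0 *: fpsX k i - l i *: fpsX k ord0) * (l ord0 ^+ q *: fps_quo i a) +
    (l i *: fpsX k ord0) *
      (l ord0 ^+ q *: fps_quo i a - fpsX k ord0 ^+ q * w i).
  rewrite mulrBl mulrBr addrA subrK; congr (_ - _).
    by rewrite fps_scalerAl fps_scalerAr scalerA exprS.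
  by rewrite fps_scalerAl fps_scalerAr mulrA exprS.
apply: spanD; last exact/spanMl/(hw i).1.
apply: spanMr; case: (unliftP ord0 i) => [j ->|->]; last first.
  by rewrite subrr; exact: span0.
exact: (span_gen elim_params j).
Qed.

End LinearChange.

(** * Finite dimensionality by elimination of parameters *)

Section DeterminantTrick.
Variables A : comNzRingType.

Lemma span_sub (r r' : nat) (h : 'I_r -> A) (h' : 'I_r' -> A) x :
  (forall i, span h' (h i)) -> span h x -> span h' x.
Proof. by move=> hh [c ->]; apply: span_sum => i _; apply: spanMr. Qed.

(** The determinant trick: the adjugate matrix turns a linear system into its
    determinant. *)
Lemma span_det (r s : nat) (h : 'I_r -> A) (N : 'M[A]_s) (b : 'I_s -> A) :
  (forall j, span h (\sum_l N j l * b l)) -> forall l, span h (\det N * b l).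
Proof.
move=> hN l; have -> : \det N * b l = \sum_j (\adj N) l j * \sum_m N j m * b m.
  transitivity (\sum_m (\adj N *m N) l m * b m).
    rewrite mul_adj_mx (bigD1 l)//= mxE eqxx mulr1n big1 ?addr0// => m ml.
    by rewrite mxE eq_sym (negPf ml) mul0r.
  rewrite (eq_bigr (fun m => \sum_j (\adj N) l j * (N j m * b m))); last first.
    by move=> m _; rewrite mxE mulr_suml; apply: eq_bigr => j _; rewrite mulrA.
  by rewrite exchange_big; apply: eq_bigr => j _; rewrite mulr_sumr.
by apply: span_sum => j _; apply: spanMl.
Qed.

Lemma horner_char_poly (B : comNzRingType) (phi : {rmorphism B -> A}) (s : nat)
    (M : 'M[B]_s) (x : A) :
  (map_poly phi (char_poly M)).[x] = \det (x%:M - map_mx phi M).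
Proof.
rewrite map_char_poly -horner_evalE -det_map_mx; congr (\det _).
apply/matrixP => i j; rewrite !mxE /= horner_evalE.
by rewrite hornerD hornerN hornerC hornerMn hornerX.
Qed.

End DeterminantTrick.

Section Dimension.
Variables (k : fieldType) (n : nat).
Hypothesis k0 : [pchar k] =i pred0.
Local Notation A := (fps k n).

(** The quotient by the ideals of z and of h is finite dimensional. The two
    families are kept apart: z consists of the parameters that remain to be
    eliminated, h of the relations that are already available. *)
Definition finite_mod (p r : nat) (z : 'I_p -> A) (h : 'I_r -> A) : Prop :=
  exists s : nat, exists b : 'I_s -> A, forall x, exists c : 'I_s -> k,
  exists y1, exists y2,
  [/\ span z y1, span h y2 & x = \sum_j c j *: b j + y1 + y2].

Lemma finite_modI (T : finType) (p r : nat) (z : 'I_p -> A) (h : 'I_r -> A)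
    (b : T -> A) : (forall x, exists c : T -> k, exists y1, exists y2,
    [/\ span z y1, span h y2 & x = \sum_j c j *: b j + y1 + y2]) ->
  finite_mod z h.
Proof.
move=> H; exists #|T|, (fun i => b (enum_val i)) => x.
have [c [y1 [y2 [h1 h2 ->]]]] := H x.
exists (fun i => c (enum_val i)), y1, y2; split=> //; congr (_ + _ + _).
by rewrite -(big_enum_val (fun j => c j *: b j)).
Qed.

(** By finiteness f is a root, modulo the ideal of h, of a monic polynomial
    over the power series in z. As f is a nonzerodivisor modulo that ideal,
    powers of the variable can be cancelled from this polynomial, so that its
    constant term may be assumed to be nonzero; it then lies in every ideal
    that contains h and f. *)
Lemma constant_term_relation (p r r' : nat) (z : 'I_p -> A) (h : 'I_r -> A)
    (h' : 'I_r' -> A) (f : A) :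
  (forall i, ordge 1 (z i)) -> finite_mod z h ->
  (forall x, span h (f * x) -> span h x) ->
  (forall x, span h x -> span h' x) -> span h' f ->
  exists2 a : fps k p, a != 0 & span h' (fps_subst z a).
Proof.
move=> hz [s [b hb]] reg hh' h'f.
have nak x : exists C : 'I_s -> fps k p, exists v : 'I_r -> A,
    x = \sum_j fps_subst z (C j) * b j + \sum_l h l * v l.
  apply: complete_nakayama => // y.
  have [c [_ [_ [[u ->] [v ->] ->]]]] := hb y.
  by exists c, u, v.
have [phi phiE] : exists phi : {rmorphism fps k p -> A},
    forall u, phi u = fps_subst z u by exists (fps_subst_rmorphism hz).
have /choice[C hC] := fun j : 'I_s => nak (f * b j).
pose M : 'M[fps k p]_s := \matrix_(j, l) C j l.
have hdet l : span h ((map_poly phi (char_poly M)).[f] * b l).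
  rewrite horner_char_poly; apply: span_det => j.
  have [v E] := hC j.
  have -> : \sum_l (f%:M - map_mx phi M) j l * b l = \sum_l h l * v l.
    apply: (addrI (\sum_l fps_subst z (C j l) * b l)); rewrite -E.
    rewrite [X in _ + X](eq_bigr (fun l => (f *+ (j == l)) * b l -
        fps_subst z (C j l) * b l)); last by move=> m _; rewrite !mxE phiE mulrBl.
    rewrite sumrB addrC subrK (bigD1 j)//= eqxx mulr1n big1 ?addr0//.
    by move=> m /negPf mj; rewrite eq_sym mj mulr0n mul0r.
  by exists v.
have hp : span h (map_poly phi (char_poly M)).[f].
  have [C1 [v E]] := nak 1.
  rewrite -[X in span h X]mulr1 E mulrDr mulr_sumr; apply: spanD.
    by apply: span_sum => j _; rewrite mulrCA; apply: spanMl.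
  by apply: spanMl; exists v.
have := monic_neq0 (char_poly_monic M); move: hp.
elim/poly_ind: (char_poly M) => [|P c IH]; first by rewrite eqxx.
rewrite rmorphD rmorphM /= map_polyX map_polyC hornerD hornerMX hornerC /= phiE => hP.
have [c0 nz|c0 _] := eqVneq c 0.
  apply: IH; last by apply: contraNneq nz => ->; rewrite c0 mul0r add0r polyC0.
  by apply: reg; move: hP; rewrite c0 fps_subst0 addr0 mulrC.
exists c => //.
rewrite -(addKr ((map_poly phi P).[f] * f) (fps_subst z c)) addrC.
by apply: spanB; [exact: hh' | exact: spanMl].
Qed.

(** Each term of a regular sequence lowers by one the number of parameters that
    are needed to make the quotient finite dimensional. The relation given by
    the constant term becomes, after a generic linear change of the parameters,
    a bound on a power of the first one. *)
Lemma parameter_step (d r r' : nat) (z : 'I_d.+1 -> A) (h : 'I_r -> A)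
    (h' : 'I_r' -> A) (f : A) :
  (forall i, ordge 1 (z i)) -> finite_mod z h ->
  (forall x, span h (f * x) -> span h x) ->
  (forall x, span h x -> span h' x) -> span h' f ->
  exists2 z' : 'I_d -> A, forall i, ordge 1 (z' i) & finite_mod z' h'.
Proof.
move=> hz fin reg hh' h'f.
have [a a0 ha] := constant_term_relation hz fin reg hh' h'f.
have [q aq lq] := fps_exact_order a0.
have [l l0 lv] := mpoly_nonvanishing k0 lq.
have [w [[g Eg] w0]] := elim_params_lead l aq.
have [w' ww'] : exists w', w * w' = 1 by apply: fps_unit; rewrite w0.
pose z' j := fps_subst z (elim_params l j); exists z'.
  move=> j; apply/ordge_subst/ordgeB; exact/ordgeZ/ordge_fpsX.
have z'E j : z' j = l ord0 *: z (lift ord0 j) - l (lift ord0 j) *: z ord0.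
  by rewrite /z' /elim_params fps_substB !fps_substZ !fps_substX.
(* Up to z', the relation a evaluated at z is z_0^q times a unit. *)
have zq : exists y1 y2, [/\ span z' y1, span h' y2 & z ord0 ^+ q = y1 + y2].
  exists (- (fps_subst z w' * \sum_j z' j * fps_subst z (g j))).
  exists (l ord0 ^+ q *: (fps_subst z w' * fps_subst z a)); split.
  - rewrite -mulrN; apply: spanMl; rewrite -[- _]sub0r; apply: spanB.
      exact: span0.
    by exists (fun j => fps_subst z (g j)).
  - by rewrite -fps_scalerAl; apply: spanMl.
  have zX j : z j = fps_subst z (fpsX k j) by rewrite fps_substX.
  pose phi : {rmorphism fps k d.+1 -> A} := fps_subst_rmorphism hz.
  have -> : \sum_j z' j * fps_subst z (g j) =
      l ord0 ^+ q *: fps_subst z a - z ord0 ^+ q * fps_subst z w.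
    rewrite [z ord0]zX -[fps_subst z _ ^+ q](rmorphXn phi) -fps_substZ.
    rewrite -fps_substM// -fps_substB Eg fps_subst_sum.
    by apply: eq_bigr => j _; rewrite fps_substM.
  rewrite mulrBr opprB fps_scalerAr subrK mulrCA -fps_substM// [w' * w]mulrC.
  by rewrite ww' fps_subst1// mulr1.
(* Modulo z' every parameter is a multiple of the first one. *)
have z0 y : span z y -> exists x, exists2 y', span z' y' & y = z ord0 * x + y'.
  case=> c ->.
  exists (\sum_i ((l ord0)^-1 * l i) *: c i).
  exists (\sum_i (z i - ((l ord0)^-1 * l i) *: z ord0) * c i).
    apply: span_sum => i _; apply: spanMr.
    case: (unliftP ord0 i) => [j ->|->]; last first.
      by rewrite mulVf// scale1r subrr; exact: span0.
    have -> : z (lift ord0 j) - ((l ord0)^-1 * l (lift ord0 j)) *: z ord0 =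
        ((l ord0)^-1 *: (1 : A)) * z' j.
      rewrite fps_scalerAl mul1r z'E scalerBr !scalerA mulVf//.
      by rewrite scale1r.
    exact/spanMl/span_gen.
  rewrite mulr_sumr -big_split; apply: eq_bigr => i _ /=.
  by rewrite mulrBl fps_scalerAl fps_scalerAr addrC subrK.
have [s [b hb]] := fin.
have H x : exists c : 'I_s -> k, exists x', exists y1, exists y2,
    [/\ span z' y1, span h' y2 &
        x = \sum_j c j *: b j + z ord0 * x' + y1 + y2].
  have [c [y [y2 [/z0[x' [y1 hy1 ->]] hy2 ->]]]] := hb x.
  by exists c, x', y1, y2; split; [|exact: hh'|rewrite addrA].
(* By iteration the products z_0^i b_j with i < t span modulo z' and z_0^t. *)
have Ht t x : exists c : nat -> 'I_s -> k, exists x', exists y1, exists y2,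
    [/\ span z' y1, span h' y2 &
        x = \sum_(i < t) \sum_j c i j *: (z ord0 ^+ i * b j) +
            z ord0 ^+ t * x' + y1 + y2].
  elim: t x => [|t IH] x.
    exists (fun _ _ => 0), x, 0, 0; split; [exact: span0|exact: span0|].
    by rewrite big_ord0 add0r mul1r !addr0.
  have [c [x' [y1 [y2 [hy1 hy2 ->]]]]] := H x.
  have [c' [x'' [y1' [y2' [hy1' hy2' ->]]]]] := IH x'.
  exists (fun i => if i is i'.+1 then c' i' else c), x''.
  exists (z ord0 * y1' + y1), (z ord0 * y2' + y2); split.
  - exact/spanD/hy1/spanMl.
  - exact/spanD/hy2/spanMl.
  rewrite big_ord_recl /= !mulrDr mulrA -exprS mulr_sumr.
  have -> : \sum_j c j *: (z ord0 ^+ 0 * b j) = \sum_j c j *: b j.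
    by apply: eq_bigr => j _; rewrite mul1r.
  have -> : \sum_(i < t) \sum_j c' i j *: (z ord0 ^+ (bump 0 i) * b j) =
      \sum_(i < t) z ord0 * \sum_j c' i j *: (z ord0 ^+ i * b j).
    apply: eq_bigr => i _; rewrite mulr_sumr; apply: eq_bigr => j _.
    by rewrite fps_scalerAr mulrA -exprS.
  rewrite -!addrA; congr (_ + (_ + (_ + (_ + _)))).
  exact: addrCA.
have [e1 [e2 [he1 he2 eq]]] := zq.
apply: (@finite_modI ('I_q * 'I_s)%type _ _ _ _
  (fun t => z ord0 ^+ t.1 * b t.2)) => x.
have [c [x' [y1 [y2 [hy1 hy2 ->]]]]] := Ht q x.
exists (fun t : 'I_q * 'I_s => c t.1 t.2), (e1 * x' + y1), (e2 * x' + y2); split.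
- exact/spanD/hy1/spanMr.
- exact/spanD/hy2/spanMr.
rewrite eq mulrDl pair_bigA /= -!addrA; congr (_ + (_ + _)).
exact: addrCA.
Qed.

End Dimension.

(** * The power series ring as a free module over the regular sequence *)

Section RegularSequence.
Variables (k : fieldType) (n : nat) (f : 'I_n -> fps k n).
Local Notation A := (fps k n).
Hypothesis f_max : forall i, max_ideal k n (f i).
Hypothesis f_reg : regular_sequence f.

Lemma regular_firsts (i : 'I_n) x :
  span (firsts f i) (f i * x) -> span (firsts f i) x.
Proof. by move=> /ideal_gen_firstsE/(f_reg.1 i)/ideal_gen_firstsE. Qed.

Lemma span_firstsS (i : nat) x : span (firsts f i) x -> span (firsts f i.+1) x.
Proof.
apply: span_sub => j; rewrite /firsts; case: ifP => ji; last exact: span0.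
by have := span_gen (firsts f i.+1) j; rewrite /firsts (ltnW ji : j < i.+1)%N.
Qed.

Lemma span_firsts_gen (i : 'I_n) : span (firsts f i.+1) (f i).
Proof. by have := span_gen (firsts f i.+1) i; rewrite /firsts ltnSn. Qed.

Lemma firsts_full : firsts f n = f.
Proof. by apply/funext => j; rewrite /firsts ltn_ord. Qed.

Lemma ordge_regular i : ordge 1 (f i).
Proof. exact/max_idealE. Qed.

(** Starting from the n variables as parameters, the n terms of the sequence
    eliminate all of them. *)
Lemma finite_quotient : [pchar k] =i pred0 -> exists s : nat,
  exists b : 'I_s -> A, forall x, exists c : 'I_s -> k,
  span f (x - \sum_j c j *: b j).
Proof.
move=> k0.
have H i d : (i + d)%N = n -> exists2 z : 'I_d -> A,
    forall j, ordge 1 (z j) & finite_mod z (firsts f i).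
  elim: i d => [|i IH] d; rewrite ?add0n ?addSn.
    move=> ->; exists (@fpsX k n); first by move=> j; exact: ordge_fpsX.
    exists 1%N, (fun=> 1) => x; exists (fun=> x mnm0), (x - x mnm0 *: (1 : A)), 0.
    split; last by rewrite big_ord1 addr0 addrC subrK.
      apply/ideal_gen_rangeE/max_idealE => m.
      rewrite ltnS leqn0 mdeg_eq0 => /eqP ->.
      by rewrite fpsDE fpsNE fpsZE -fps_mon0 /fps_mon eqxx mulr1 subrr.
    exact: span0.
  rewrite -addnS => id; have [z hz fin] := IH _ id.
  have lt : (i < n)%N by rewrite -id addnS ltnS leq_addr.
  apply: (parameter_step k0 hz fin (f := f (Ordinal lt))).
  - exact: (@regular_firsts (Ordinal lt)).
  - exact: span_firstsS.
  - exact: (span_firsts_gen (Ordinal lt)).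
have [z _ [s [b hb]]] := H n 0%N (addn0 n).
exists s, b => x; have [c [y1 [y2 [[u y1E] hy2 xE]]]] := hb x.
exists c; rewrite xE y1E big_ord0 addr0 addrC addKr.
by move: hy2; rewrite firsts_full.
Qed.

(** A spanning family of least cardinality is a basis. *)
Lemma basis_quotient : [pchar k] =i pred0 -> exists e : nat,
  exists2 b : 'I_e -> A,
    forall x, exists c : 'I_e -> k, span f (x - \sum_j c j *: b j) &
    forall c : 'I_e -> k, span f (\sum_j c j *: b j) -> forall j, c j = 0.
Proof.
move=> /finite_quotient; pose Q s := exists b : 'I_s -> A, forall x,
  exists c : 'I_s -> k, span f (x - \sum_j c j *: b j).
rewrite -/(exists s, Q s) => -[s0 hs0].
have ex : exists s, `[< Q s >] by exists s0; apply/asboolP.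
have [e /asboolP[b hb] emin] := ex_minnP ex.
exists e, b => // c hc j; apply/eqP/negPn/negP => cj.
case: e => [|e] in b hb emin c hc j cj *; first by case: j {cj}.
suff /asboolP/emin : Q e by rewrite ltnn.
exists (b \o lift j) => x; have [a ha] := hb x.
exists (fun i => a (lift j i) - a j / c j * c (lift j i)).
have -> : x - \sum_i (a (lift j i) - a j / c j * c (lift j i)) *: (b \o lift j) i =
    (x - \sum_i a i *: b i) + (a j / c j) *: (\sum_i c i *: b i).
  rewrite !(bigD1_ord j)//= scalerDr scalerA divfK//.
  rewrite [a j *: b j + _]addrC opprD [X in _ = X + _]addrA subrKA -addrA.
  congr (_ + _).
  rewrite scaler_sumr -!sumrN -big_split; apply: eq_bigr => i _ /=.
  by rewrite scalerA scalerBl opprB addrC.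
apply: spanD => //; rewrite -[\sum_i _]mul1r -fps_scalerAl.
exact: spanMl.
Qed.

Variables (e : nat) (b : 'I_e -> A).
Hypothesis b_span :
  forall x, exists c : 'I_e -> k, span f (x - \sum_j c j *: b j).
Hypothesis b_free :
  forall c : 'I_e -> k, span f (\sum_j c j *: b j) -> forall j, c j = 0.

Lemma quotient_generates x :
  exists C : 'I_e -> A, x = \sum_j fps_subst f (C j) * b j.
Proof.
have [|C [v ->]] := @complete_nakayama k n n 0 e f (fun=> 0) b ordge_regular _ x.
  move=> y; have [c [u hu]] := b_span y.
  exists c, u, (fun=> 0); rewrite big_ord0 addr0 -hu addrC subrK//.
by exists C; rewrite big_ord0 addr0.
Qed.

(** Coefficients that involve only the variables of index at least i are
    determined modulo the first i terms of the sequence: the part without the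
    variable of index i is determined modulo the first i + 1 terms, and what
    remains can be divided by f i. *)
Lemma subst_free_firsts (i : nat) (C : 'I_e -> A) : (i <= n)%N ->
  (forall j (m : multinom n),
     (exists2 l : 'I_n, (l < i)%N & m l != 0%N) -> C j m = 0) ->
  span (firsts f i) (\sum_j fps_subst f (C j) * b j) -> forall j, C j = 0.
Proof.
move: {2}(n - i)%N (erefl (n - i)%N) => t.
elim: t i C => [|t IH] i C.
  move=> /eqP; rewrite subn_eq0 => ni ine.
  have {ni ine} -> : i = n by apply/eqP; rewrite eqn_leq ine.
  rewrite firsts_full => supp.
  have CE j : C j = C j mnm0 *: (1 : A).
    apply/funext => m; rewrite fpsZE -fps_mon0 /fps_mon.
    have [->|m0] := eqVneq m mnm0; first by rewrite mulr1.
    rewrite mulr0; apply: supp; apply: contrapT => h; case/eqP: m0.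
    apply/mnmP => l; rewrite mnm0E; apply/eqP/negPn/negP => ml.
    by apply: h; exists l.
  move=> h j; rewrite CE (b_free (c := fun j => C j mnm0)) ?scale0r//.
  move: h; congr (span f _); apply: eq_bigr => l _.
  rewrite {1}CE fps_substZ fps_subst1; last exact: ordge_regular.
  by rewrite fps_scalerAl mul1r.
move=> ti ine supp h.
have lt : (i < n)%N by rewrite -subn_gt0 ti.
pose v := Ordinal lt.
have divX (D : 'I_e -> A) :
    (forall j (m : multinom n),
       (exists2 l : 'I_n, (l < i)%N & m l != 0%N) -> D j m = 0) ->
    span (firsts f i) (\sum_j fps_subst f (D j) * b j) ->
    let D1 j : A := fun m => D j (mnm_add m (mnm1 v)) in
    (forall j, D j = fpsX k v * D1 j) /\
    span (firsts f i) (\sum_j fps_subst f (D1 j) * b j).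
  move=> {C supp h} suppD hD D1.
  pose D0 j : A := fun m => if m v == 0%N then D j m else 0.
  have DE j : D j = D0 j + fpsX k v * D1 j.
    apply/funext => m; rewrite fpsDE fps_XmulE /D0 /D1.
    case: eqP => [_|/eqP mv]; [by rewrite addr0 | rewrite add0r].
    congr (D j _); apply/mnmP => l; rewrite mnmDE mnmBE mnm1E subnK//.
    by case: eqP => // <-; rewrite lt0n.
  have sumE : \sum_j fps_subst f (D j) * b j =
      \sum_j fps_subst f (D0 j) * b j + f v * \sum_j fps_subst f (D1 j) * b j.
    rewrite mulr_sumr -big_split; apply: eq_bigr => j _ /=.
    have hf := ordge_regular.
    by rewrite {1}DE fps_substD fps_substM// fps_substX// mulrDl mulrA.
  have D00 : forall j, D0 j = 0.
    apply: (IH i.+1) => //; first by rewrite subnS ti.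
      move=> j m [l]; rewrite ltnS leq_eqVlt /D0 => /orP[/eqP li|li] ml.
        by rewrite ifF//; apply/negbTE; rewrite (_ : v = l)//; apply: val_inj.
      by case: ifP => // _; apply: suppD; exists l.
    rewrite -[X in span _ X](addrK (f v * \sum_j fps_subst f (D1 j) * b j)).
    rewrite -sumE; apply: spanB; first exact: span_firstsS.
    exact/spanMr/(span_firsts_gen v).
  split=> [j|]; first by rewrite {1}DE D00 add0r.
  apply: (@regular_firsts v); move: hD; rewrite sumE big1 ?add0r// => l _.
  by rewrite D00 fps_subst0 mul0r.
suff main u : forall D : 'I_e -> A,
    (forall j (m : multinom n),
       (exists2 l : 'I_n, (l < i)%N & m l != 0%N) -> D j m = 0) ->
    span (firsts f i) (\sum_j fps_subst f (D j) * b j) ->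
    forall j (m : multinom n), m v = u -> D j m = 0.
  by move=> j; apply/funext => m; exact: main supp h j m erefl.
elim: u => [|u IHu] D suppD hD j m mv.
all: have [-> hD1] := divX _ suppD hD; rewrite fps_XmulE mv //=.
apply: (IHu _ _ hD1); last by rewrite mnmBE mv mnm1E eqxx subn1.
move=> {m mv}{}j m [l li ml]; apply: suppD; exists l => //.
by rewrite mnmDE addn_eq0 (negPf ml).
Qed.

(** Coordinates are unique: the ideal of the first 0 terms is zero. *)
Lemma quotient_free (C : 'I_e -> A) :
  \sum_j fps_subst f (C j) * b j = 0 -> forall j, C j = 0.
Proof.
move=> h; apply: (@subst_free_firsts 0) => //; first by move=> j m [].
by rewrite h; exact: span0.
Qed.

(** A basis modulo the regular sequence is a basis over the power series in the
    sequence. *)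
Lemma quotient_basis_via : basis_via (fps_subst f) b.
Proof.
move=> x; have [C xE] := quotient_generates x.
exists [ffun j => C j]; split.
  by rewrite xE; apply: eq_bigr => j _; rewrite ffunE.
move=> D xD; apply/ffunP => j; rewrite ffunE; apply/eqP; rewrite -subr_eq0.
apply/eqP; apply: (quotient_free (C := fun j => C j - D j)).
transitivity (x - x); last exact: subrr.
rewrite {1}xE xD -sumrB; apply: eq_bigr => l _.
by rewrite fps_substB mulrBl.
Qed.

End RegularSequence.

(** * Powers of the ideal in coordinates, and the Samuel multiplicity *)

Section Coordinates.
Variables (k : fieldType) (n e : nat).
Variables (f : 'I_n -> fps k n) (b : 'I_e -> fps k n).
Local Notation A := (fps k n).
Local Notation I := (ideal_gen (range f)).
Hypothesis f_ord : forall i, ordge 1 (f i).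
Hypothesis b_basis : basis_via (fps_subst f) b.

Lemma ideal_exp_subst m (c : A) : ordge m c -> ideal_exp I m (fps_subst f c).
Proof.
move=> /max_ideal_expE; elim: m c => [//|m IH] c /ideal_expSE[y hy ->].
apply/ideal_expSE; exists (fun i => fps_subst f (y i)) => [i|]; first exact: IH.
rewrite fps_subst_sum; apply: eq_bigr => i _.
by rewrite fps_substM// fps_substX.
Qed.

Lemma basis_via_inj (C D : 'I_e -> A) :
  \sum_j fps_subst f (C j) * b j = \sum_j fps_subst f (D j) * b j -> C =1 D.
Proof.
move=> E j; have [c [_ cu]] := b_basis (\sum_j fps_subst f (C j) * b j).
have -> : C j = [ffun j => C j] j by rewrite ffunE.
have -> : D j = [ffun j => D j] j by rewrite ffunE.
rewrite -(cu [ffun j => C j]); last by apply: eq_bigr => l _; rewrite ffunE.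
rewrite -(cu [ffun j => D j])// E; by apply: eq_bigr => l _; rewrite ffunE.
Qed.

(** The ideal is generated by the images of the variables of the base, so that
    its m-th power is the m-th power of the maximal ideal of the base times the
    free module. This holds for every basis, not only for those that come from
    a basis of the quotient by the ideal. *)
Lemma ideal_exp_coords m (C : 'I_e -> A) :
  ideal_exp I m (\sum_j fps_subst f (C j) * b j) <-> forall j, ordge m (C j).
Proof.
split; last first.
  move=> hC; apply: ideal_exp_sum => j _; rewrite mulrC.
  exact/ideal_expMl/ideal_exp_subst.
have H m' x : ideal_exp I m' x -> exists2 D : 'I_e -> A,
    forall j, ordge m' (D j) & x = \sum_j fps_subst f (D j) * b j.
  elim: m' x => [|m' IH] x.
    by have [c [-> _]] := b_basis x; exists c.
  move=> /ideal_expSE[y hy ->].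
  have /choice[D hD] : forall i, exists D : 'I_e -> A,
      (forall j, ordge m' (D j)) /\ y i = \sum_j fps_subst f (D j) * b j.
    by move=> i; have [D ? ?] := IH _ (hy i); exists D.
  exists (fun j => \sum_i fpsX k i * D i j).
    move=> j; apply: ordge_sum => i _; rewrite -add1n; apply: ordgeM.
      exact: ordge_fpsX.
    exact: (hD i).1.
  rewrite (eq_bigr (fun i => \sum_j f i * (fps_subst f (D i j) * b j))).
    rewrite exchange_big; apply: eq_bigr => j _ /=.
    rewrite fps_subst_sum mulr_suml; apply: eq_bigr => i _.
    by rewrite fps_substM// fps_substX// mulrA.
  by move=> i _; rewrite (hD i).2 mulr_sumr.
by move=> /H[D hD /basis_via_inj E] j; rewrite E.
Qed.

(** The products of a monomial of degree less than m in the sequence and a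
    basis element form a basis of the quotient by the m-th power. *)
Lemma dim_quotient_exp m :
  dim_quotient (ideal_exp I m) #|{: 'I_e * bmultinom n m}|.
Proof.
pose T := ('I_e * bmultinom n m)%type.
pose beta (t : T) : A := fps_subst f (fps_mon t.2) * b t.1.
exists (fun i => beta (enum_val i)) => x.
pose P (c : T -> k) j : A := \sum_(v : bmultinom n m) c (j, v) *: fps_mon v.
have sumE (c : T -> k) : \sum_(i < #|{: T}|) c (enum_val i) *: beta (enum_val i) =
    \sum_j fps_subst f (P c j) * b j.
  rewrite -(big_enum_val (fun t => c t *: beta t)) /=.
  rewrite (eq_bigr (fun j => \sum_(v : bmultinom n m) c (j, v) *: beta (j, v))).
    by rewrite pair_bigA /=; apply: eq_bigr => -[].
  move=> j _; rewrite /P fps_subst_sum mulr_suml; apply: eq_bigr => v _.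
  by rewrite fps_substZ fps_scalerAl.
have PE (c : T -> k) j (v : bmultinom n m) : P c j v = c (j, v).
  rewrite /P fps_sumE (bigD1 v)//= fpsZE /fps_mon eqxx mulr1.
  rewrite big1 ?addr0// => w wv; rewrite fpsZE.
  by rewrite [bmnm v == w]eq_sym -bmeqP (negPf wv) mulr0.
have [C [xE _]] := b_basis x.
have key (c : T -> k) : ideal_exp I m
    (x - \sum_(i < #|{: T}|) c (enum_val i) *: beta (enum_val i)) <->
    forall t, c t = C t.1 t.2.
  have -> : x - \sum_(i < #|{: T}|) c (enum_val i) *: beta (enum_val i) =
      \sum_j fps_subst f (C j - P c j) * b j.
    rewrite sumE xE -sumrB; apply: eq_bigr => j _.
    by rewrite fps_substB mulrBl.
  rewrite ideal_exp_coords; split=> [h [j v]|h j v vm].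
    have := h j v (bmdeg v); rewrite fpsDE fpsNE PE => /eqP.
    by rewrite subr_eq0 => /eqP ->.
  by rewrite fpsDE fpsNE (PE c j (BMultinom vm)) h subrr.
pose ct (t : T) : k := C t.1 t.2.
exists [ffun i => ct (enum_val i)]; split.
  rewrite (eq_bigr (fun i => ct (enum_val i) *: beta (enum_val i))).
    by apply/key.
  by move=> i _; rewrite ffunE.
move=> c hc; apply/ffunP => i; rewrite ffunE.
have H : forall t : T, c (enum_rank t) = C t.1 t.2.
  apply: (key (fun t : T => c (enum_rank t))).1.
  rewrite (eq_bigr (fun i => c i *: beta (enum_val i)))// => j _.
  by rewrite enum_valK.
by have := H (enum_val i); rewrite enum_valK.
Qed.

End Coordinates.

(** The exponents of a monomial of degree at most m are bounded by m, which
    identifies these monomials with partial partitions of m. *)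
Lemma card_bmultinom n m : #|{: bmultinom n m.+1}| = 'C(n + m, n).
Proof.
rewrite -card_partial_ord_partitions.
pose F (v : bmultinom n m.+1) : n.-tuple 'I_m.+1 := [tuple inord (v i) | i < n].
have vle (v : bmultinom n m.+1) i : (v i < m.+1)%N.
  by apply: leq_ltn_trans (bmdeg v); rewrite mdegE (bigD1 i)//= leq_addr.
have Finj : injective F.
  move=> v w E; apply/val_inj/mnmP => i /=.
  have := congr1 (fun t => val (tnth t i)) E.
  by rewrite !tnth_mktuple /= !inordK.
rewrite -(card_imset _ Finj); apply: eq_card => t; rewrite !inE.
apply/imsetP/idP => [[v _ ->]|ht].
  rewrite big_tuple (eq_bigr (fun i => v i)).
    by rewrite -mdegE -ltnS bmdeg.
  by move=> i _; rewrite tnth_mktuple inordK.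
have lt : (mdeg (Multinom [tuple nat_of_ord (tnth t i) | i < n]) < m.+1)%N.
  rewrite mdegE ltnS; move: ht; rewrite big_tuple; congr (_ <= _)%N.
  by apply: eq_bigr => i _; rewrite mnm_tnth tnth_mktuple.
exists (BMultinom lt) => //; apply: eq_from_tnth => i.
by rewrite tnth_mktuple /= mnm_tnth tnth_mktuple inord_val.
Qed.

(** One more variable multiplies the falling factorial by n + m + 1 and the
    denominator by m + 1, and the quotient of these factors tends to 1. *)
Lemma cvg_card_bmultinom (R : realType) n :
  (n`! * #|{: bmultinom n m}|)%N%:R / m%:R ^+ n @[m --> \oo] --> (1 : R).
Proof.
suff H : ((n + m) ^_ n)%:R / m.+1%:R ^+ n @[m --> \oo] --> (1 : R).
  rewrite -cvg_shiftS; apply: cvg_trans H; apply: near_eq_cvg.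
  by apply: nearW => m /=; rewrite card_bmultinom mulnC bin_ffact.
elim: n => [|n IH].
  rewrite (_ : (fun _ => _) = fun=> 1); first exact: cvg_cst.
  by apply/funext => m; rewrite ffactn0 expr0 divr1.
rewrite (_ : (fun _ => _) = (fun m => (1 + n%:R * m.+1%:R^-1) *
    (((n + m) ^_ n)%:R / m.+1%:R ^+ n) : R)); last first.
  apply/funext => m; rewrite addSn ffactSS natrM exprS invfM mulrACA.
  congr (_ * _); rewrite -[X in X + _](@mulfV _ m.+1%:R) ?pnatr_eq0//.
  by rewrite -mulrDl -natrD addSn [(m + n)%N]addnC.
rewrite -[X in _ --> X]mul1r; apply: cvgM => //.
rewrite -[X in _ --> X]addr0; apply: cvgD; first exact: cvg_cst.
rewrite -(mulr0 n%:R); apply: cvgM; first exact: cvg_cst.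
exact: cvg_harmonic.
Qed.

(** * Weights of characteristic polynomials *)

Section Weights.
Variables (k : fieldType) (n N m : nat).
Local Notation A := (fps k n).
Implicit Types (p q : {poly A}).

Lemma fps_coefM_eq0 (a b : A) (mu : multinom n) :
  (forall m1 m2, (mdeg m1 + mdeg m2)%N = mdeg mu -> a m1 * b m2 = 0) ->
  (a * b) mu = 0.
Proof.
move=> h; rewrite fps_mul_def /fps_mul big1// => p /eqP/(congr1 mdeg).
by rewrite mdegD => E; apply: h; rewrite -E.
Qed.

(** The weight filtration in which the series variables have weight N and the
    polynomial variable has weight m. *)
Definition wge (s : nat) p := forall i (mu : multinom n),
  (N * mdeg mu + m * i < s)%N -> p`_i mu = 0.

Lemma wge0 s : wge s 0.
Proof. by move=> i mu _; rewrite coef0. Qed.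

Lemma wgeD s p q : wge s p -> wge s q -> wge s (p + q).
Proof. by move=> hp hq i mu h; rewrite coefD fpsDE hp// hq// addr0. Qed.

Lemma wgeM s t p q : wge s p -> wge t q -> wge (s + t) (p * q).
Proof.
move=> hp hq i mu h; rewrite coefM fps_sumE big1// => j _.
apply: fps_coefM_eq0 => m1 m2 E.
have [lt|le] := ltnP (N * mdeg m1 + m * j) s; first by rewrite hp// mul0r.
rewrite [X in _ * X]hq ?mulr0// -(ltn_add2l s); apply: leq_ltn_trans h.
rewrite -E mulnDr -{3}(subnKC (leq_ord j)) mulnDr addnACA.
by rewrite leq_add2r.
Qed.

Lemma wge_det (e s : nat) (M : 'M[{poly A}]_e) :
  (forall i j, wge s (M i j)) -> wge (e * s) (\det M).
Proof.
move=> hM; apply: big_ind; [exact: wge0 | exact: wgeD | move=> t _].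
rewrite -[(e * s)%N]add0n; apply: wgeM => //.
have -> : (e * s = \sum_(i < e) s)%N by rewrite sum_nat_const card_ord.
elim/big_rec2: _ => // i w p _ IH; exact: wgeM.
Qed.

Hypothesis N_gt0 : (0 < N)%N.

(** The least weight s of a term of p, together with the smallest exponent i of
    the polynomial variable at which it occurs and the order d of the
    coefficient there. *)
Definition has_weight p (s : nat) := exists i d,
  [/\ wge s p, (N * d + m * i = s)%N, lform d p`_i != 0 &
      forall j, (j < i)%N -> forall mu, p`_j mu != 0 ->
        (s < N * mdeg mu + m * j)%N].

Lemma has_weight_exists p : p != 0 -> exists s, has_weight p s.
Proof.
move=> p0; pose Q s := exists i, exists2 mu : multinom n,
  p`_i mu != 0 & (N * mdeg mu + m * i = s)%N.
have exQ : exists s, `[< Q s >].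
  have [d _ /lform_eq0[mu _ ne]] : exists2 d, ordge d (lead_coef p) &
      lform d (lead_coef p) != 0 by apply: fps_exact_order; rewrite lead_coef_eq0.
  exists (N * mdeg mu + m * (size p).-1)%N; apply/asboolP.
  by exists (size p).-1, mu.
have [s /asboolP[i0 [mu0 ne0 E0]] smin] := ex_minnP exQ.
have hw : wge s p.
  move=> i mu lt; apply/eqP; apply: contraTT lt => ne; rewrite -leqNgt.
  by apply: smin; apply/asboolP; exists i, mu.
have exi : exists i, `[< exists2 mu : multinom n,
    p`_i mu != 0 & (N * mdeg mu + m * i = s)%N >].
  by exists i0; apply/asboolP; exists mu0.
have [i /asboolP[mu ne E] imin] := ex_minnP exi.
exists s, i, (mdeg mu); split=> //; first exact: lform_neq0 ne.
move=> j ji nu nej; rewrite ltn_neqAle; apply/andP; split.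
  apply: contraTneq ji => sE; rewrite -leqNgt; apply: imin.
  by apply/asboolP; exists nu.
by apply: smin; apply/asboolP; exists j, nu.
Qed.

(** The weight is a valuation, by the argument of Gauss: in the coefficient of
    index i + j the product of the leading forms at i and j is not cancelled,
    because every other contribution has larger weight. *)
Lemma has_weightM p q s t : has_weight p s -> has_weight q t ->
  exists i, exists2 mu : multinom n,
    (p * q)`_i mu != 0 & (N * mdeg mu + m * i = s + t)%N.
Proof.
move=> [i [d [hp pE pl pmin]]] [j [d' [hq qE ql qmin]]].
have ordp : ordge d p`_i.
  move=> mu lt; apply: hp; rewrite -pE ltn_add2r ltn_pmul2l//.
have ordq : ordge d' q`_j.
  move=> mu lt; apply: hq; rewrite -qE ltn_add2r ltn_pmul2l//.
have /lform_eq0[mu muE ne] : lform (d + d') (p`_i * q`_j) != 0.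
  by rewrite lformM// mulf_neq0.
exists (i + j)%N, mu; last by rewrite muE !mulnDr -pE -qE addnACA.
have lt : (i < (i + j).+1)%N by rewrite ltnS leq_addr.
rewrite coefM fps_sumE (bigD1 (Ordinal lt))//= addKn big1 ?addr0//.
move=> l li; apply: fps_coefM_eq0 => m1 m2; rewrite muE => muE'.
apply/eqP; rewrite mulf_eq0 -[_ || _]negbK negb_or; apply/negP => /andP[ne1 ne2].
have w1 : (s <= N * mdeg m1 + m * l)%N.
  by rewrite leqNgt; apply: contra ne1 => h; rewrite hp.
have w2 : (t <= N * mdeg m2 + m * (i + j - l))%N.
  by rewrite leqNgt; apply: contra ne2 => h; rewrite hq.
have tot : (N * mdeg m1 + m * l + (N * mdeg m2 + m * (i + j - l)) = s + t)%N.
  rewrite addnACA -!mulnDr muE' subnKC ?leq_ord//.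
  by rewrite !mulnDr -pE -qE addnACA.
suff : (s + t < s + t)%N by rewrite ltnn.
rewrite -{2}tot; case: (ltngtP l i) => [lti|gti|eqi].
- by rewrite -addSn; apply: leq_add => //; apply: pmin.
- rewrite -addnS; apply: leq_add => //; apply: qmin => //.
  by rewrite ltn_subLR ?leq_ord// ltn_add2r.
- by case/eqP: li; apply: val_inj.
Qed.

(** If the N-th power of M is divisible by the m-th power of the maximal ideal,
    then the characteristic polynomial of M, which divides that of its N-th
    power evaluated at the N-th power of the variable, has weight at least m
    times its degree. The cofactor is monic, and so does not have a larger
    weight than its leading term. *)
Lemma char_poly_weight (e : nat) (M : 'M[A]_e) :
  (forall i j, ordge m ((M ^+ N) i j)) -> wge (m * e) (char_poly M).
Proof.
move=> hM; pose X : 'M[{poly A}]_e := 'X%:M.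
pose Mp : 'M[{poly A}]_e := map_mx polyC M.
pose Q := \det (X ^+ N - Mp ^+ N).
have XN : X ^+ N = ('X^N)%:M.
  rewrite /X; elim: {hM} N => [|j IH]; first by rewrite !expr0.
  by rewrite !exprS IH -mulmxE -scalar_mxM.
have MN : Mp ^+ N = map_mx polyC (M ^+ N).
  rewrite /Mp; elim: {XN hM} N => [|j IH]; first by rewrite !expr0 map_mx1.
  by rewrite !exprS IH -!mulmxE map_mxM.
have Qw : wge (e * (N * m)) Q.
  apply: wge_det => i j; rewrite XN MN => l mu.
  rewrite !mxE coefB coefMn coefXn coefC fpsDE fpsNE => h.
  have [l0|l0] := eqVneq l 0%N.
    rewrite (hM i j mu); last first.
      by move: h; rewrite l0 muln0 addn0 ltn_mul2l N_gt0.
    by rewrite l0 eq_sym (gtn_eqF N_gt0) mul0rn subrr.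
  have [lN|_] := eqVneq l N; last by rewrite mul0rn subrr.
  by move: h; rewrite lN [(m * N)%N]mulnC ltnNge leq_addl.
have QE : Q = char_poly (M ^+ N) \Po 'X^N.
  rewrite /Q XN MN /char_poly -[_ \Po _]/(comp_poly _ _) -det_map_mx.
  congr (\det _); apply/matrixP => i j; rewrite !mxE /=.
  by rewrite comp_polyB comp_polyC raddfMn /= comp_polyX.
(* The cofactor R below inherits its leading coefficient 1 from Q. *)
have Qtop : Q`_(N * e) = 1.
  rewrite QE coef_comp_poly_Xn// dvdn_mulr// mulKn//.
  by have /monicP := char_poly_monic (M ^+ N); rewrite lead_coefE size_char_poly.
have Qsize : size Q = (N * e).+1.
  apply/eqP; rewrite eqn_leq; apply/andP; split.
    apply/leq_sizeP => j lt; rewrite QE coef_comp_poly_Xn//.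
    case: ifP => // /dvdnP[i jE]; rewrite nth_default// size_char_poly jE mulnK//.
    by move: lt; rewrite jE [(i * N)%N]mulnC ltn_pmul2l.
  rewrite ltnNge; apply/negP => /leq_sizeP/(_ _ (leqnn _))/eqP.
  by rewrite Qtop oner_eq0.
have Pm := char_poly_monic M.
have [R QR] : exists R, Q = char_poly M * R.
  rewrite /Q subrXX_comm.
    by rewrite -mulmxE det_mulmx; eexists.
  by rewrite /GRing.comm /X -!mulmxE scalar_mxC.
have R0 : R != 0.
  by apply/eqP => R0; move: Qsize; rewrite QR R0 mulr0 size_poly0.
have [s Ps] := has_weight_exists (monic_neq0 Pm).
have [t Rt] := has_weight_exists R0.
have [i [mu ne E]] := has_weightM Ps Rt.
have tle : (t <= m * (size R).-1)%N.
  have [_ [_ [Rw _ _ _]]] := Rt; rewrite leqNgt; apply/negP => lt.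
  have : R`_(size R).-1 mnm0 = 0 by apply: Rw; rewrite mdeg0 muln0.
  have -> : R`_(size R).-1 = 1.
    rewrite -lead_coefE -(lead_coef_monicM _ Pm) -QR lead_coefE Qsize.
    exact: Qtop.
  by rewrite -fps_mon0 /fps_mon eqxx => /eqP; rewrite oner_eq0.
have Rs : (e + (size R).-1 = N * e)%N.
  have := size_monicM Pm R0; rewrite -QR Qsize size_char_poly addSn /= => H.
  by apply: succn_inj; rewrite H -addnS prednK ?size_poly_gt0.
have Qst : (e * (N * m) <= s + t)%N.
  by rewrite -E leqNgt; apply: contra ne => lt; rewrite QR in Qw; rewrite Qw.
have sle : (m * e <= s)%N.
  rewrite -(leq_add2r (m * (size R).-1)) -mulnDr Rs.
  apply: leq_trans (leq_add (leqnn s) tle); apply: leq_trans Qst.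
  by rewrite [(N * e)%N]mulnC mulnCA [(m * N)%N]mulnC.
have [_ [_ [Pw _ _ _]]] := Ps.
by move=> l nu lt; apply: Pw; apply: leq_trans lt sle.
Qed.

End Weights.

(** * Orders of the powers of an element *)

Section MultiplicationMatrix.
Variables (k : fieldType) (n e : nat) (f : 'I_n -> fps k n) (g : fps k n).
Variables (b : 'I_e -> fps k n) (M : 'M[fps k n]_e).
Local Notation A := (fps k n).
Local Notation I := (ideal_gen (range f)).
Hypothesis f_ord : forall i, ordge 1 (f i).
Hypothesis b_basis : basis_via (fps_subst f) b.
Hypothesis M_mul : forall j, g * b j = \sum_(i < e) fps_subst f (M i j) * b i.

Lemma mul_matrix_exp N j :
  g ^+ N * b j = \sum_(i < e) fps_subst f ((M ^+ N) i j) * b i.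
Proof.
elim: N j => [|N IH] j.
  rewrite !expr0 mul1r (bigD1 j)//= mxE eqxx fps_subst1// mul1r.
  by rewrite big1 ?addr0// => i /negPf ij; rewrite mxE ij fps_subst0 mul0r.
rewrite exprSr -mulrA M_mul mulr_sumr.
rewrite (eq_bigr (fun l => \sum_i fps_subst f ((M ^+ N) i l * M l j) * b i)).
  rewrite exchange_big; apply: eq_bigr => i _ /=.
  by rewrite exprSr -mulmxE mxE fps_subst_sum mulr_suml.
move=> l _; rewrite mulrCA IH mulr_sumr; apply: eq_bigr => i _.
by rewrite fps_substM// mulrA [_ * fps_subst f (M l j)]mulrC.
Qed.

(** The determinant trick annihilates the basis elements, and hence 1, which is
    a combination of them. *)
Lemma mul_Cayley_Hamilton :
  \sum_(i < e.+1) fps_subst f (char_poly M)`_i * g ^+ i = 0.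
Proof.
have [phi phiE] : exists phi : {rmorphism A -> A},
    forall u, phi u = fps_subst f u by exists (fps_subst_rmorphism f_ord).
pose h0 : 'I_0 -> A := fun=> 0.
have h0E x : span h0 x -> x = 0 by case=> c ->; rewrite big_ord0.
suff H : (map_poly phi (char_poly M)).[g] = 0.
  rewrite -[RHS]H (@horner_coef_wide _ e.+1).
    by apply: eq_bigr => i _; rewrite coef_map /= phiE.
  by apply: leq_trans (size_poly _ _) _; rewrite size_char_poly.
rewrite horner_char_poly -det_tr.
set N := (_^T); have key l : \det N * b l = 0.
  apply: h0E; apply: span_det => j.
  have -> : \sum_l N j l * b l = 0; last exact: span0.
  rewrite (eq_bigr (fun l => (g *+ (l == j)) * b l -
      fps_subst f (M l j) * b l)); last first.
    by move=> i _; rewrite /N !mxE phiE mulrBl.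
  rewrite sumrB -M_mul (bigD1 j)//= eqxx mulr1n big1 ?addr0 ?subrr//.
  by move=> i /negPf ->; rewrite mulr0n mul0r.
have [c [E _]] := b_basis 1.
rewrite -[LHS]mulr1 E mulr_sumr big1// => i _.
by rewrite mulrCA key mulr0.
Qed.

(** If g^N lies in the m-th power of the ideal, then every entry of the N-th
    power of the matrix has order at least m. *)
Lemma mul_exp_weight N m : (0 < N)%N -> ideal_exp I m (g ^+ N) ->
  forall i mu, (char_poly M)`_i mu != 0 -> (m * (e - i) <= N * mdeg mu)%N.
Proof.
move=> N0 h i mu ne; rewrite mulnBr leq_subLR addnC leqNgt.
apply: contra ne => lt; apply/eqP; apply: (char_poly_weight N0 _ lt).
move=> i' j; move: i'; apply/(ideal_exp_coords f_ord b_basis).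
by rewrite -mul_matrix_exp mulrC; apply: ideal_expMl.
Qed.

Variable R : realType.

(** The exponent is bounded below by a real number, so that bounds can be added
    without rounding. *)
Definition ideal_expR (r : R) (x : A) := exists2 m, r <= m%:R & ideal_exp I m x.

Lemma ideal_expR0 (r : R) : ideal_expR r 0.
Proof.
exists (Num.bound `|r|); last exact: ideal_exp0.
exact/(le_trans (ler_norm _))/ltW/archi_boundP.
Qed.

Lemma ideal_expR_sum (r : R) (T : Type) (s : seq T) (P : pred T) (F : T -> A) :
  (forall i, P i -> ideal_expR r (F i)) ->
  ideal_expR r (\sum_(i <- s | P i) F i).
Proof.
move=> hF; apply: big_ind => //; first exact: ideal_expR0.
move=> x y [m rm hx] [m' rm' hy]; exists (minn m m').
  by case: (leqP m m').
apply: ideal_expD.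
  exact: ideal_exp_leq (geq_minl _ _) hx.
exact: ideal_exp_leq (geq_minr _ _) hy.
Qed.

(** The Cayley-Hamilton relation expresses g^N through the e preceding powers
    of g, with coefficients whose orders make up for the lower exponents. *)
Lemma mul_exp_lower (r : R) : 0 <= r ->
  (forall i mu, (char_poly M)`_i mu != 0 ->
     r * (e%:R - i%:R) <= (mdeg mu)%:R) ->
  forall N, ideal_expR (r * (N%:R - e%:R)) (g ^+ N).
Proof.
move=> r0 hr N; elim/ltn_ind: N => N IH.
have [lt|le] := ltnP N e.
  exists 0%N => //; apply: mulr_ge0_le0 => //.
  by rewrite subr_le0 ler_nat ltnW.
have topE : (char_poly M)`_e = 1.
  by have /monicP := char_poly_monic M; rewrite lead_coefE size_char_poly.
have -> : g ^+ N =
    - \sum_(i < e) fps_subst f (char_poly M)`_i * g ^+ (i + (N - e)).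
  have := mul_Cayley_Hamilton; rewrite big_ord_recr /= topE fps_subst1// mul1r.
  move/(congr1 ( *%R^~ (g ^+ (N - e)))); rewrite mul0r mulrDl -exprD subnKC//.
  move/eqP; rewrite addrC addr_eq0 => /eqP ->; rewrite mulr_suml; congr (- _).
  by apply: eq_bigr => i _; rewrite -mulrA -exprD.
rewrite -sumrN; apply: ideal_expR_sum => i _.
have [m rm hm] : ideal_expR (r * ((i + (N - e))%:R - e%:R)) (g ^+ (i + (N - e))).
  by apply: IH; rewrite -[X in (_ < X)%N](subnKC le) ltn_add2r.
(* A zero coefficient contributes zero, which lies in every power. *)
have [c0|c0] := eqVneq (char_poly M)`_i 0.
  by rewrite c0 fps_subst0 mul0r oppr0; exact: ideal_expR0.
have [d hd /lform_eq0[mu muE ne]] := fps_exact_order c0.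
exists (d + m)%N; last first.
  rewrite -mulNr -mulN1r -mulrA; apply/ideal_expMl/ideal_expMD => //.
  exact: ideal_exp_subst.
rewrite natrD; apply: le_trans (lerD (_ : r * (e%:R - i%:R) <= _) rm).
  rewrite -mulrDr ler_wpM2l// natrD natrB//.
  by rewrite -[i%:R + _ - _]addrA subrKA addrCA subrr addr0.
by rewrite -muE; apply: hr.
Qed.

End MultiplicationMatrix.

(** * Convergence of the orders, and the theorem *)

Section Orders.
Variable R : realType.

Lemma ediv_nat (x : \bar R) i : (0 < i)%N ->
  (x / i%:R%:E = x * (i%:R^-1)%:E)%E.
Proof. by move=> i0; rewrite inver pnatr_eq0 gtn_eqF. Qed.

Lemma ideal_ord_ge (A : comNzRingType) (I : set A) (x : A) m :
  ideal_exp I m x -> (m%:R%:E <= ideal_ord R I x)%E.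
Proof. by move=> h; apply: ereal_sup_ubound; exists m. Qed.

Lemma ideal_ord_le (A : comNzRingType) (I : set A) (x : A) (y : \bar R) :
  (forall m, ideal_exp I m x -> (m%:R%:E <= y)%E) -> (ideal_ord R I x <= y)%E.
Proof. by move=> h; apply: ge_ereal_sup => _ [m hm <-]; exact: h. Qed.

Lemma bigmin_nat_le (F : nat -> \bar R) m i : (0 < i <= m)%N ->
  (\big[Order.min/+oo]_(1 <= j < m.+1) F j <= F i)%E.
Proof.
by move=> im; apply: ge_bigmin_seq => //; rewrite mem_index_iota ltnS.
Qed.

Lemma le_bigmin_nat1 (F : nat -> \bar R) m y :
  (forall i, (0 < i <= m)%N -> (y <= F i)%E) ->
  (y <= \big[Order.min/+oo]_(1 <= j < m.+1) F j)%E.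
Proof.
move=> h; rewrite big_seq; apply: le_bigmin; first exact: leey.
by move=> i; rewrite mem_index_iota ltnS; exact: h.
Qed.

(** The lower bound is required for all real r at most l, so that an infinite
    limit is covered as well: r can then be taken arbitrarily large. *)
Lemma cvg_linear_lower (u : nat -> \bar R) (l : \bar R) (c : R) :
  (0 <= l)%E -> (forall N, (0 < N)%N -> (u N <= l)%E) ->
  (forall r : R, 0 <= r -> (r%:E <= l)%E -> forall N, (0 < N)%N ->
     ((r * (N%:R - c) / N%:R)%:E <= u N)%E) ->
  u N @[N --> \oo] --> l.
Proof.
move=> l0 ul lu.
have lim (r : R) : r * (N%:R - c) / N%:R @[N --> \oo] --> r.
  rewrite -cvg_shiftS /=.
  have : r * (1 - c * N.+1%:R^-1) @[N --> \oo] --> r * (1 - c * 0).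
    apply: cvgM; first exact: cvg_cst.
    apply: cvgB; first exact: cvg_cst.
    by apply: cvgM; [exact: cvg_cst | exact: cvg_harmonic].
  rewrite mulr0 subr0 mulr1; apply: cvg_trans; apply: near_eq_cvg.
  by apply: nearW => N /=; rewrite -mulrA mulrBl divff ?pnatr_eq0.
case: l l0 ul lu => [r| |//] l0 ul lu.
  apply: (@squeeze_cvge _ _ _ _
    (fun N => (r * (N%:R - c) / N%:R)%:E) _ (fun=> r%:E)).
  - near=> N; have N0 : (0 < N)%N by near: N; exact: nbhs_infty_gt.
    by rewrite ul// lu.
  - by apply: cvg_EFin; [exact: nearW | exact: lim].
  - exact: cvg_cst.
apply/cvgeyPge => B.
have hB : \forall N \near \oo, B <= (`|B| + 1) * (N%:R - c) / N%:R.
  have /cvgr_ge := lim (`|B| + 1); apply.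
  by apply: le_lt_trans (ler_norm B) _; rewrite ltrDl.
near=> N; have N0 : (0 < N)%N by near: N; exact: nbhs_infty_gt.
apply: le_trans (lu (`|B| + 1) _ _ N N0); rewrite ?lee_fin ?leey//.
by near: N.
Unshelve. all: end_near. Qed.

End Orders.

Theorem mainTheorem2 (R : realType) (k : fieldType) (n : nat)
    (f : 'I_n -> fps k n) (g : fps k n) :
  [pchar k] =i pred0 ->
  (forall i, max_ideal k n (f i)) ->
  regular_sequence f ->
  exists e : nat,
    [/\ samuel_multiplicity R (ideal_gen (range f)) e,
        dim_quotient (ideal_gen (range f)) e,
        free_via (fps_subst f) e &
        forall P : {poly fps k n},
          char_poly_via (fps_subst f) e (fun x => g * x) P ->
          cvgn (samuel_seq R (ideal_gen (range f)) g) /\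
          asymptotic_samuel R (ideal_gen (range f)) g =
            \big[Order.min/+oo%E]_(1 <= i < e.+1)
              (ideal_ord R (max_ideal k n) P`_(e - i) / i%:R%:E)%E].
Proof.
move=> k0 f_max f_reg.
have f_ord := ordge_regular f_max.
have [e [b b_span b_free]] := basis_quotient f_reg k0.
have b_basis := quotient_basis_via f_max f_reg b_span b_free.
exists e; split.
- exists (fun m => #|{: 'I_e * bmultinom n m}|).
    by move=> m; exact: dim_quotient_exp b_basis m.
  rewrite -[X in _ --> X]mulr1.
  have : e%:R * ((n`! * #|{: bmultinom n m}|)%N%:R / m%:R ^+ n) @[m --> \oo]
      --> (e%:R * 1 : R).
    by apply: cvgM; [exact: cvg_cst | exact: cvg_card_bmultinom].
  apply: cvg_trans; apply: near_eq_cvg; apply: nearW => m /=.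
  by rewrite card_prod card_ord mulnCA [in RHS]natrM mulrA.
- exists b => x; have [c hc] := b_span x.
  exists [ffun j => c j]; split.
    apply/ideal_gen_rangeE.
    by rewrite (eq_bigr (fun j => c j *: b j))// => j _; rewrite ffunE.
  move=> d /ideal_gen_rangeE hd; apply/ffunP => j; rewrite ffunE.
  apply/eqP; rewrite -subr_eq0; apply/eqP.
  apply: (b_free (fun j => c j - d j)).
  rewrite (eq_bigr (fun j => c j *: b j - d j *: b j)).
    by rewrite sumrB -[_ - _](subrKA x) -[_ - x]opprB addrC; exact: spanB.
  by move=> i _; rewrite scalerBl.
- by exists b.
move=> _ [b' [M [b'_basis M_mul ->]]].
set u := samuel_seq R _ g.
set l := (X in _ /\ _ = X).
suff cvgu : u N @[N --> \oo] --> l.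
  by split; [apply/cvg_ex; exists l | exact/cvg_lim].
apply: (@cvg_linear_lower _ _ _ e%:R).
- apply: le_bigmin_nat1 => i /andP[i0 _]; rewrite ediv_nat// lee_pdivlMr ?ltr0n//.
  by rewrite mul0e; exact: (@ideal_ord_ge R _ _ _ 0%N).
- move=> N N0; apply: le_bigmin_nat1 => i /andP[i0 ie].
  rewrite /u /samuel_seq ediv_nat// lee_pdivrMr ?ltr0n//.
  apply: ideal_ord_le => m hm.
  rewrite ediv_nat// muleAC lee_pdivlMr ?ltr0n//.
  have hw := mul_exp_weight f_ord b'_basis M_mul N0 hm (i := (e - i)%N).
  have [d hd hmd] : exists2 d, ordge d (char_poly M)`_(e - i) & (m * i <= N * d)%N.
    (* The order of a zero coefficient is infinite, so that any d is a lower
       bound for it. *)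
    have [->|a0] := eqVneq (char_poly M)`_(e - i) 0.
      by exists (m * i)%N; [exact: ordge0 | exact: leq_pmull].
    have [d hd /lform_eq0[mu muE ne]] := fps_exact_order a0.
    by exists d => //; have := hw mu ne; rewrite subKn// muE.
  apply: (@le_trans _ _ ((N * d)%N%:R%:E)).
    by rewrite -EFinM lee_fin -natrM ler_nat.
  rewrite mulnC natrM EFinM lee_pmul2r ?fin_numE// ?lte_fin ?ltr0n//.
  exact/ideal_ord_ge/max_ideal_expE.
move=> r r0 rl N N0.
have hr i mu : (char_poly M)`_i mu != 0 -> r * (e%:R - i%:R) <= (mdeg mu)%:R.
  move=> ne; have ie : (i <= e)%N.
    rewrite -ltnS -(size_char_poly M) ltnNge; apply: contra ne => le.
    by rewrite nth_default.
  have [->|ie'] := eqVneq i e; first by rewrite subrr mulr0.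
  have ei0 : (0 < e - i)%N by rewrite subn_gt0 ltn_neqAle ie' ie.
  have range : (0 < e - i <= e)%N by rewrite ei0 leq_subr.
  have := le_trans rl (bigmin_nat_le _ range); rewrite subKn// ediv_nat//.
  rewrite lee_pdivlMr ?ltr0n// -natrB// => h.
  rewrite -lee_fin EFinM; apply: le_trans h _; apply: ideal_ord_le => m.
  move=> /max_ideal_expE hm; rewrite lee_fin ler_nat leqNgt.
  by apply: contra ne => lt; rewrite hm.
have [m rm hm] := mul_exp_lower f_ord b'_basis M_mul r0 hr N.
rewrite /u /samuel_seq ediv_nat// lee_pdivlMr ?ltr0n//.
rewrite -EFinM divfK ?pnatr_eq0 -?lt0n//.
by apply: le_trans (ideal_ord_ge R hm); rewrite lee_fin.
Qed.
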